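(* Let $D_1$ be a vf-safe delta-matroid on $E_1$ in which every element is non-singular. Let $D_2$ be a vf-safe delta-matroid with non-singular element $a$ and let $E'=E(D_2)-\{a\}$. Suppose that $D_1\otimes_\Phi D_2$ is a tensor product along $a$ with $\Phi=\{\phi_e:e\in E_1\}$. Then \[ Q(D_1\otimes_\Phi D_2;(\boldsymbol u,\boldsymbol v,\boldsymbol w),t)=Q\big(D_1;\{u_e=\phi_e^{-1}(p),\ v_e=\phi_e^{-1}(q),\ w_e=\phi_e^{-1}(r)\}_{e\in E_1},t\big),\] where $(p,q,r)$ is the unique solution to the following system of linear equations in the ring $\mathbb Z[t,\{u_e,v_e,w_e\}_{e\in E'}]$: \begin{align*} Q(D_2/a;\{u_e,v_e,w_e\}_{e\in E'},t)&=tp+q+r,\\ Q(D_2\backslash a;\{u_e,v_e,w_e\}_{e\in E'},t)&=p+tq+r,\\ Q((D_2+a)/a;\{u_e,v_e,w_e\}_{e\in E'},t)&=p+q+tr. \end{align*}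
   Context: A delta-matroid is a pair $D=(E,\mathcal F)$ with $E$ a finite set (ground set, also written $E(D)$; $D$ is said to be on $E$) and $\mathcal F$ a non-empty collection of subsets of $E$ (feasible sets) such that for all $X,Y\in\mathcal F$ and $u\in X\bigtriangleup Y$ there is $v\in X\bigtriangleup Y$ (possibly $v=u$) with $X\bigtriangleup\{u,v\}\in\mathcal F$. A coloop is an element in every feasible set; a loop is an element in no feasible set. An isomorphism of delta-matroids is a bijection of ground sets preserving feasible sets. If $e$ is not a coloop, $D\backslash e=(E-\{e\},\{F\in\mathcal F:e\notin F\})$. If $e$ is not a loop, $D/e=(E-\{e\},\{F-\{e\}:F\in\mathcal F,\ e\in F\})$. If $e$ is a loop or coloop, whichever of $D\backslash e$, $D/e$ is so far undefined is set equal to the other. Twist: $D*A=(E,\{X\bigtriangleup A:X\in\mathcal F\})$ for $A\subseteq E$. Loop complement: $D+e=(E,\mathcal F\bigtriangleup\{X\cup\{e\}:X\in\mathcal F,\ e\notin X\})$; loop complements for different elements commute, and $D+A$ is obtained by loop complementing each element of $A$. $D$ is vf-safe if every sequence of twists and loop complements applied to $D$ gives a delta-matroid. For vf-safe $D$, $D\,\overline{*}\,e=((D+e)*\{e\})+e$, and for $A\subseteq E$, $D\,\overline{*}\,A$ is obtained by applying $\overline{*}\,e$ for each $e\in A$ in turn (the order is irrelevant). An element $e$ is singular if it is a coloop, or a loop, or $F\bigtriangleup\{e\}$ is feasible for every feasible set $F$. Two-sum of vf-safe delta-matroids: the $e$-type of a feasible set $F$ is $e$-positive if $e\in F$ and $F-\{e\}$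 is not feasible; $e$-negative if $e\notin F$ and $F\cup\{e\}$ is not feasible; $e$-mixed if $F\bigtriangleup\{e\}$ is feasible. If $D_1=(E_1,\mathcal F_1)$, $D_2=(E_2,\mathcal F_2)$ are vf-safe with $E_1\cap E_2=\{e\}$ and $e$ non-singular in both, then $D_1\oplus_2 D_2$ is the (vf-safe) delta-matroid with ground set $(E_1\cup E_2)-\{e\}$ and feasible sets $\{(F_1\cup F_2)-\{e\}:F_1\in\mathcal F_1,F_2\in\mathcal F_2,\text{ the }e\text{-types of }F_1\text{ and }F_2\text{ are different}\}$. Tensor product: let $D_1$ be a vf-safe delta-matroid on $E_1$ in which every element is non-singular; let $\{D_e:e\in E_1\}$ be vf-safe delta-matroids with pairwise disjoint ground sets and $E_1\cap E(D_e)=\{e\}$ for all $e\in E_1$; let $D_2$ be a vf-safe delta-matroid with a non-singular element $a$; for each $e\in E_1$ let $\phi_e$ be an isomorphism from $D_e$ to $D_2$ with $\phi_e(e)=a$; let $\Phi=\{\phi_e:e\in E_1\}$. The tensor product $D_1\otimes_\Phi D_2$ along $a$ is the delta-matroid obtained from $D_1$ by successively forming the two-sum with $D_e$ along $e$ for every $e\in E_1$ (the order does not matter). Multivariate transition polynomial of a vf-safe delta-matroid $D$ on $E$: with formal variables $\boldsymbol u=\{u_e\}_{e\in E}$, $\boldsymbol v=\{v_e\}_{e\in E}$, $\boldsymbol w=\{w_e\}_{e\in E}$, $t$, \[Q(D;(\boldsymbol u,\boldsymbol v,\boldsymbol w),t)=\sum_{(\Lambda,M,N)}\Big(\prod_{e\in\Lambda}u_e\Big)\Big(\prod_{e\in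 M}v_e\Big)\Big(\prod_{e\in N}w_e\Big)t^{d_{D\overline{*}N}(\Lambda)},\] summed over ordered partitions $(\Lambda,M,N)$ of $E$ into three possibly empty blocks, where $d_{D}(X)=\min_{F\in\mathcal F(D)}|F\bigtriangleup X|$. It is also written $Q(D;\{u_e,v_e,w_e\}_{e\in E},t)$; writing $u_e=\ldots$ inside $Q$ means substitution for that variable. For an isomorphism $\phi:D\to D'$ of delta-matroids, $\phi$ also denotes the ring isomorphism $\mathbb Z[t,\{u_e,v_e,w_e\}_{e\in E(D)}]\to\mathbb Z[t,\{u_e,v_e,w_e\}_{e\in E(D')}]$ with $u_e\mapsto u_{\phi(e)}$, $v_e\mapsto v_{\phi(e)}$, $w_e\mapsto w_{\phi(e)}$, $t\mapsto t$. *)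

(* Defs.v *)
From mathcomp Require Import all_boot all_order all_algebra.
From mathcomp Require Import mpoly.

Set Implicit Arguments.
Unset Strict Implicit.
Unset Printing Implicit Defensive.

Import GRing.Theory.
Local Open Scope ring_scope.

Definition symdiff (T : finType) (A B : {set T}) : {set T} :=
  (A :\: B) :|: (B :\: A).

(* All ground sets are subsets of one finite universe T.  The operations below
   are total on set systems; delta_matroid and vf_safe are predicates. *)
Record set_system (T : finType) : Type := SetSystem {
  ground : {set T};
  feasible : {set {set T}}
}.

Section DeltaMatroids.
Variable T : finType.
Implicit Types (D : set_system T) (A F X Y : {set T}) (e : T).

Definition delta_matroid D : Prop :=
  [/\ feasible D != set0,
      (forall F, F \in feasible D -> F \subset ground D) &
      forall X Y u, X \in feasible D -> Y \in feasible D ->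
        u \in symdiff X Y ->
        exists2 v, v \in symdiff X Y
                 & symdiff X [set u; v] \in feasible D].

Definition coloop D e : bool := [forall F in feasible D, e \in F].
Definition loop D e : bool := [forall F in feasible D, e \notin F].
Definition singular D e : bool :=
  [|| coloop D e, loop D e
    | [forall F in feasible D, symdiff F [set e] \in feasible D]].

Definition raw_delete D e : set_system T :=
  SetSystem (ground D :\ e) [set F in feasible D | e \notin F].
Definition raw_contract D e : set_system T :=
  SetSystem (ground D :\ e) [set F :\ e | F in feasible D & e \in F].

Definition delete D e : set_system T :=
  if coloop D e then raw_contract D e else raw_delete D e.
Definition contract D e : set_system T :=
  if loop D e then raw_delete D e else raw_contract D e.

Definition twist D A : set_system T :=
  SetSystem (ground D) [set symdiff X A | X in feasible D].

Definition loop_compl D e : set_system T :=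
  SetSystem (ground D)
    (symdiff (feasible D) [set e |: X | X in feasible D & e \notin X]).

Inductive vf_reachable D : set_system T -> Prop :=
| vf_refl : vf_reachable D D
| vf_twist D' A :
    vf_reachable D D' -> A \subset ground D' -> vf_reachable D (twist D' A)
| vf_loop_compl D' e :
    vf_reachable D D' -> e \in ground D' -> vf_reachable D (loop_compl D' e).

Definition vf_safe D : Prop :=
  forall D', vf_reachable D D' -> delta_matroid D'.

(* D \bar* e, and D \bar* A one element at a time: for vf-safe D
   the order of the elements is irrelevant. *)
Definition dual_pivot1 D e : set_system T :=
  loop_compl (twist (loop_compl D e) [set e]) e.
Definition dual_pivot D A : set_system T := foldl dual_pivot1 D (enum A).

Definition e_positive D e F : bool := (e \in F) && (F :\ e \notin feasible D).
Definition e_negative D e F : bool := (e \notin F) && (e |: F \notin feasible D).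
Definition e_mixed D e F : bool := symdiff F [set e] \in feasible D.

Definition same_etype D1 D2 e (F1 F2 : {set T}) : bool :=
  [|| e_positive D1 e F1 && e_positive D2 e F2,
      e_negative D1 e F1 && e_negative D2 e F2
    | e_mixed D1 e F1 && e_mixed D2 e F2].

(* Intended for vf-safe D1 and D2 whose ground sets meet exactly in e, with e
   non-singular in both. *)
Definition two_sum D1 D2 e : set_system T :=
  SetSystem ((ground D1 :|: ground D2) :\ e)
    [set (FF.1 :|: FF.2) :\ e | FF : {set T} * {set T} in
       [set FF | [&& FF.1 \in feasible D1, FF.2 \in feasible D2
                   & ~~ same_etype D1 D2 e FF.1 FF.2]]].

(* Only the restriction of phi to ground D matters. *)
Definition dm_iso D D' (phi : T -> T) : Prop :=
  [/\ {in ground D &, injective phi},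
      phi @: ground D = ground D' &
      forall F, F \subset ground D ->
        (phi @: F \in feasible D') = (F \in feasible D)].

Definition tensor_family D1 D2 (a : T)
    (De : T -> set_system T) (phi : T -> T -> T) : Prop :=
  [/\ {in ground D1, forall e, vf_safe (De e)},
      {in ground D1 &, forall e f, e != f ->
         [disjoint ground (De e) & ground (De f)]},
      {in ground D1, forall e, ground D1 :&: ground (De e) = [set e]} &
      {in ground D1, forall e, dm_iso (De e) D2 (phi e) /\ phi e e = a}].

(* D is obtained from D1 by two-sums with the De e along e, for the elements e
   of the ground set of D1 taken in some order s. *)
Definition is_tensor D1 (De : T -> set_system T) D : Prop :=
  exists2 s : seq T, perm_eq s (enum (ground D1))
                   & D = foldl (fun D' e => two_sum D' (De e) e) D1 s.

(* The neutral value #|T| is an upper bound of all the |F symdiff X|, so this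
   is the minimum whenever there is a feasible set. *)
Definition dist D X : nat :=
  \big[minn/#|T|]_(F in feasible D) #|symdiff F X|.

(* Formal variables t, u_e, v_e, w_e. *)
Definition tvar : finType := option (T + T + T)%type.
Definition tv : tvar := None.
Definition uv (e : T) : tvar := Some (inl (inl e)).
Definition vv (e : T) : tvar := Some (inl (inr e)).
Definition wv (e : T) : tvar := Some (inr e).

(* Z[t, {u_e, v_e, w_e}_{e in T}], containing all the rings
   Z[t, {u_e, v_e, w_e}_{e in A}] as subrings. *)
Local Notation tpoly := {mpoly int[#|tvar|]}.

Definition tX (x : tvar) : tpoly := 'X_(enum_rank x).

Definition tvars_on A : {set tvar} :=
  tv |: (uv @: A :|: vv @: A :|: wv @: A).

(* Membership in the subring Z[t, {u_e, v_e, w_e}_{e in A}]. *)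
Definition poly_on A (p : tpoly) : Prop :=
  forall m, m \in msupp p ->
  forall i, m i != 0%N -> enum_val i \in tvars_on A.

Definition tsubst (s : tvar -> tpoly)
    (p : tpoly) : tpoly :=
  comp_mpoly [tuple s (enum_val i) | i < #|tvar|] p.

(* The ring morphism induced by a map of elements. *)
Definition rename_var (f : T -> T) (x : tvar) : tvar :=
  match x with
  | None => tv
  | Some (inl (inl e)) => uv (f e)
  | Some (inl (inr e)) => vv (f e)
  | Some (inr e) => wv (f e)
  end.
Definition rename (f : T -> T) : tpoly -> tpoly :=
  tsubst (fun x => tX (rename_var f x)).

(* Inverse of the bijection phi : A -> phi @: A. *)
Definition inv_on A (phi : T -> T) (y : T) : T :=
  odflt y [pick x in A | phi x == y].

(* The ring isomorphism phi^-1 for an isomorphism phi from D. *)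
Definition iso_inv D (phi : T -> T) :
    tpoly -> tpoly :=
  rename (inv_on (ground D) phi).

Definition ordered_partition3 A (P : {set T} * {set T} * {set T}) : bool :=
  let: (L, M, N) := P in
  [&& L :|: M :|: N == A, [disjoint L & M], [disjoint L & N] & [disjoint M & N]].

Definition Q D : tpoly :=
  \sum_(P : {set T} * {set T} * {set T} | ordered_partition3 (ground D) P)
    let: (L, M, N) := P in
    (\prod_(e in L) tX (uv e)) * (\prod_(e in M) tX (vv e))
      * (\prod_(e in N) tX (wv e)) * tX tv ^+ dist (dual_pivot D N) L.

(* The substitution u_e = U e, v_e = V e, w_e = W e for e in A. *)
Definition subst_uvw A (U V W : T -> tpoly) :
    tpoly -> tpoly :=
  tsubst (fun x =>
    match x with
    | None => tX tv
    | Some (inl (inl e)) => if e \in A then U e else tX (uv e)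
    | Some (inl (inr e)) => if e \in A then V e else tX (vv e)
    | Some (inr e) => if e \in A then W e else tX (wv e)
    end).

Definition transition_system D2 (a : T) (p q r : tpoly) : Prop :=
  [/\ poly_on (ground D2 :\ a) p /\ poly_on (ground D2 :\ a) q
        /\ poly_on (ground D2 :\ a) r,
      Q (contract D2 a) = tX tv * p + q + r,
      Q (delete D2 a) = p + tX tv * q + r &
      Q (contract (loop_compl D2 a) a) = p + q + tX tv * r].

End DeltaMatroids.

(* Main.v *)
Require Import Defs.
From mathcomp Require Import all_boot all_order all_algebra.
From mathcomp Require Import mpoly.
From HB Require Import structures.
From mathcomp Require Import zify ring.

(* Record, for X not containing e, whether X and e |: X are feasible, as a
   vector of F_2^2.  A feasible set of the two-sum along e is then a union of
   X1 and X2 whose vectors have nonzero determinant, so twists and dual pivots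
   away from e commute with the two-sum.  For a vf-safe D2 with e nonsingular,
   and a fixed state (L2, N2) of the other elements, let m be the least distance
   to L2 of a set with nonzero vector.  The exchange axiom, applied also after
   loop complementing and dual pivoting e, shows that distance m is attained by
   only one of the three nonzero vectors, say c, and that some other vector
   occurs at distance m + 1.  Hence extending (L2, N2) by the states u, v, w of e
   gives distances m, m and m + 1 in some order determined by c, and minimising
   over both summands shows that in the two-sum (L1, N1) and (L2, N2) together
   have distance m plus the distance of the extension of (L1, N1) by the state
   of e that c singles out.  Summing t^m over the (L2, N2) that single out u, v,
   w gives p, q, r, for which both the linear system and the substitution
   formula can be read off. *)

Set Implicit Arguments.
Unset Strict Implicit.
Unset Printing Implicit Defensive.

Import GRing.Theory.

(** * Set systems and vectors of types *)

Lemma in_symdiff (T : finType) (A B : {set T}) x :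
  (x \in symdiff A B) = (x \in A) (+) (x \in B).
Proof. by rewrite !inE; case: (x \in A); case: (x \in B). Qed.

Section Systems.
Variable T : finType.
Implicit Types (D : set_system T) (A F L N X Y Z : {set T}) (e x : T).

Lemma symdiffK A : involutive (fun X => symdiff X A).
Proof. by move=> X; apply/setP=> x; rewrite !in_symdiff addbK. Qed.

Lemma symdiff1 A e : symdiff A [set e] = if e \in A then A :\ e else e |: A.
Proof.
apply/setP=> x; case: ifP => eA; rewrite in_symdiff !inE;
by case: (eqVneq x e) => [->|]; rewrite ?eA ?addbF.
Qed.

Lemma set_system_eq D D' :
  ground D = ground D' -> feasible D =i feasible D' -> D = D'.
Proof. by case: D D' => [E S] [E' S'] /= -> /setP ->. Qed.

Lemma mem_twist D A F :
  (F \in feasible (twist D A)) = (symdiff F A \in feasible D).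
Proof.
apply/imsetP/idP => [[X XD ->]|FD]; first by rewrite symdiffK.
by exists (symdiff F A); rewrite ?symdiffK.
Qed.

Lemma mem_loop_compl D e F : (F \in feasible (loop_compl D e)) =
  (F \in feasible D) (+) ((e \in F) && (F :\ e \in feasible D)).
Proof.
rewrite in_symdiff; congr (_ (+) _); apply/imsetP/andP => [[X]|[eF FD]].
  by rewrite inE => /andP[XD eX] ->; rewrite setU11 setU1K.
by exists (F :\ e); rewrite ?setD1K // inE FD setD11.
Qed.

(** Over F_2, loop complement is a shear, and conjugating the twist at [e] by it gives the
    transposed shear: values on sets containing [e] are added to those on sets avoiding it. *)
Lemma mem_dual_pivot1 D e F : (F \in feasible (dual_pivot1 D e)) =
  (F \in feasible D) (+) ((e \notin F) && (e |: F \in feasible D)).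
Proof.
rewrite mem_loop_compl !mem_twist !mem_loop_compl !symdiff1.
case: (boolP (e \in F)) => eF; rewrite ?setD11 /=.
  by rewrite (setD1K eF) eF !addbF [_ (+) (_ \in _)]addbC addKb.
by rewrite setU11 (setU1K eF) /= !addbF addbC.
Qed.

Lemma mem_raw_contract D e X :
  (X \in feasible (raw_contract D e)) = (e \notin X) && (e |: X \in feasible D).
Proof.
apply/imsetP/andP => [[F]|[eX FD]].
  by rewrite inE => /andP[FD eF] ->; rewrite setD11 setD1K.
by exists (e |: X); rewrite ?setU1K // inE FD setU11.
Qed.

Lemma mem_raw_delete D e X :
  (X \in feasible (raw_delete D e)) = (X \in feasible D) && (e \notin X).
Proof. by rewrite inE. Qed.

Lemma dual_pivot1C D x y :
  dual_pivot1 (dual_pivot1 D x) y = dual_pivot1 (dual_pivot1 D y) x.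
Proof.
case: (eqVneq x y) => [->|nxy] //.
apply: set_system_eq => // F; rewrite !mem_dual_pivot1 !inE.
rewrite (negPf nxy) [y == x]eq_sym (negPf nxy) /= setUCA.
case: (x \in F); case: (y \in F) => //=; rewrite ?addbF //.
by rewrite -!addbA; congr (_ (+) _); rewrite addbCA.
Qed.

(** [dual_pivot] enumerates its set in one fixed order; since dual pivots commute, any other
    enumeration may be substituted. *)
Lemma foldl_dual_pivot_perm D s1 s2 : perm_eq s1 s2 ->
  foldl (@dual_pivot1 T) D s1 = foldl (@dual_pivot1 T) D s2.
Proof.
have C1 s x D' : foldl (@dual_pivot1 T) (dual_pivot1 D' x) s =
    dual_pivot1 (foldl (@dual_pivot1 T) D' s) x.
  by elim: s D' => //= y s IH D'; rewrite -IH dual_pivot1C.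
have C s t D' : foldl (@dual_pivot1 T) D' (s ++ t) =
    foldl (@dual_pivot1 T) D' (t ++ s).
  elim: s D' => [|x s IH] D' /=; first by rewrite cats0.
  by rewrite IH !foldl_cat /= C1.
move=> p12; pose P s := foldl (@dual_pivot1 T) D s1 = foldl (@dual_pivot1 T) D s.
(* A permutation is reached by exchanging adjacent blocks, and [C] performs such an exchange. *)
apply: (@catCA_perm_ind _ P _ s1 s2) => // u v w; rewrite /P => ->.
by rewrite !catA !(foldl_cat _ _ _ w) C.
Qed.

Lemma dual_pivot0 D : dual_pivot D set0 = D.
Proof. by rewrite /dual_pivot enum_set0. Qed.

Lemma dual_pivotU1 D e N : e \notin N ->
  dual_pivot D (e |: N) = dual_pivot1 (dual_pivot D N) e.
Proof.
move=> eN; rewrite -foldl_rcons; apply: foldl_dual_pivot_perm.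
apply: uniq_perm; rewrite ?rcons_uniq ?enum_uniq ?mem_enum ?eN //.
by move=> x; rewrite mem_rcons in_cons !mem_enum !inE.
Qed.

Lemma dual_pivotU D N1 N2 : [disjoint N1 & N2] ->
  dual_pivot D (N1 :|: N2) = dual_pivot (dual_pivot D N1) N2.
Proof.
move=> d12; rewrite /dual_pivot -foldl_cat; apply: foldl_dual_pivot_perm.
apply: uniq_perm; rewrite ?cat_uniq ?enum_uniq ?andbT //=.
  apply/hasPn => x; rewrite !mem_enum => xN2; apply/negP => xN1.
  by rewrite (disjointFr d12 xN1) in xN2.
by move=> x; rewrite mem_cat !mem_enum inE.
Qed.

Lemma dual_pivot_ind (P : set_system T -> Prop) D N :
  P D -> (forall D' x, P D' -> x \in N -> P (dual_pivot1 D' x)) ->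
  P (dual_pivot D N).
Proof.
move=> PD IH; rewrite /dual_pivot.
have: {subset enum N <= N} by move=> x; rewrite mem_enum.
elim: (enum N) D PD => //= x s IHs D PD sN.
apply: IHs => [|y ys]; last by apply: sN; rewrite inE ys orbT.
by apply: IH => //; apply: sN; rewrite inE eqxx.
Qed.

Lemma ground_dual_pivot D N : ground (dual_pivot D N) = ground D.
Proof. by apply: (dual_pivot_ind (P := fun D' => ground D' = ground D)). Qed.

Definition proper_system D := forall F, F \in feasible D -> F \subset ground D.

Lemma proper_dual_pivot D N : N \subset ground D ->
  proper_system D -> proper_system (dual_pivot D N).
Proof.
move=> sN pD; pose P D' := ground D' = ground D /\ proper_system D'.
suff [] : P (dual_pivot D N) by [].
apply: dual_pivot_ind => // D' x [gD' pD'] xN; split=> // F.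
rewrite mem_dual_pivot1; case: (boolP (F \in feasible D')) => [/pD'//|_] /=.
case/andP=> _ /pD'; apply: subset_trans; exact: subsetUr.
Qed.

(* The values of the indicator of D on X and e |: X, as a vector of F_2^2;
   cross is the determinant, nonzero exactly on pairs of distinct nonzero
   vectors. *)
Definition etype D e X : bool * bool :=
  (X \in feasible D, e |: X \in feasible D).
Definition cross (b c : bool * bool) : bool :=
  (b.1 && c.2) (+) (b.2 && c.1).
Definition ff : bool * bool := (false, false).

Lemma crossE b c : cross b c = [&& b != ff, c != ff & b != c].
Proof. by case: b c => [[] []] [[] []]. Qed.

Lemma crossC b c : cross b c = cross c b.
Proof. by case: b c => [[] []] [[] []]. Qed.

Lemma etype_twist D e L X : e \notin L ->
  etype (twist D L) e X = etype D e (symdiff X L).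
Proof.
move=> eL; rewrite /etype !mem_twist.
suff -> : symdiff (e |: X) L = e |: symdiff X L by [].
apply/setP=> x; rewrite !inE; case: (eqVneq x e) => [->|] //=.
by rewrite eL.
Qed.

(** At [e] itself the operations permute the nonzero vectors: the dual pivot swaps (0,1) and (1,1),
    loop complement swaps (1,0) and (1,1), the twist swaps (1,0) and (0,1). Arguments for one type
    thus carry over to the others. *)
Lemma etype_dual_pivot1 D e X : e \notin X ->
  etype (dual_pivot1 D e) e X =
    ((etype D e X).1 (+) (etype D e X).2, (etype D e X).2).
Proof.
by move=> eX; rewrite /etype !mem_dual_pivot1 eX setU11 /= addbF.
Qed.

Lemma etype_loop_compl D e X : e \notin X ->
  etype (loop_compl D e) e X =
    ((etype D e X).1, (etype D e X).1 (+) (etype D e X).2).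
Proof.
move=> eX; rewrite /etype !mem_loop_compl (negPf eX) setU11 /= addbF.
by rewrite setU1K // addbC.
Qed.

(** For [x] outside [X] the vectors of [X] and [x |: X] are added, and the determinant is linear.
    The form with a fixed [c] is the one met in two-sums and minors. *)
Lemma etype_dual_pivot1_neq D e x X : x != e ->
  forall c, cross (etype (dual_pivot1 D x) e X) c =
  cross (etype D e X) c (+) ((x \notin X) && cross (etype D e (x |: X)) c).
Proof.
move=> xe c; rewrite /cross /etype !mem_dual_pivot1 /= !inE (negPf xe) /=.
rewrite setUCA; case: (x \in X); rewrite /= ?addbF //.
case: c => [[] []] /=; rewrite ?andbT ?andbF ?addbF //.
by rewrite addbACA.
Qed.

End Systems.

(** * Distances in two-sums *)

Section Distances.
Variable T : finType.
Implicit Types (D : set_system T) (A F L N X Y Z : {set T}) (e x : T).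
Implicit Types (b c : bool * bool).

Lemma dist_le D X F : F \in feasible D -> dist D X <= #|symdiff F X|.
Proof.
move=> FD; rewrite /dist; elim: (index_enum _) (mem_index_enum F) => //= G r IH.
rewrite inE big_cons => /predU1P[<-|Fr]; first by rewrite FD geq_minl.
by case: ifP => _; rewrite ?geq_min IH ?orbT.
Qed.

Lemma dist_attained D X : feasible D != set0 ->
  exists2 F, F \in feasible D & #|symdiff F X| = dist D X.
Proof.
case/set0Pn=> F0 F0D.
have: dist D X = #|T| \/
    exists2 F, F \in feasible D & #|symdiff F X| = dist D X.
  rewrite /dist; elim/big_rec: _ => [|F k FD IH]; first by left.
  rewrite minnE; case: (leqP #|symdiff F X| k) => h.
    by right; exists F => //; lia.
  by rewrite subnBA; [|lia]; have -> : (#|symdiff F X| + k - #|symdiff F X| = k)%N by lia.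
(* If the minimum equals the neutral value [#|T|], every feasible set attains it, since no
   cardinality exceeds [#|T|]. *)
case=> // dT; exists F0 => //; apply/eqP; rewrite eqn_leq dist_le // andbT dT.
exact: max_card.
Qed.

Lemma dist_eq D X k :
  (exists2 F, F \in feasible D & #|symdiff F X| <= k) ->
  (forall F, F \in feasible D -> k <= #|symdiff F X|) -> dist D X = k.
Proof.
move=> [F FD Fk] lb; apply/eqP; rewrite eqn_leq (leq_trans (dist_le _ FD)) //=.
have [|G GD <-] := @dist_attained D X; last exact: lb.
by apply/set0Pn; exists F.
Qed.

Lemma card_symdiffD1 e F G :
  #|symdiff F G| = (#|symdiff (F :\ e) (G :\ e)| + ((e \in F) (+) (e \in G)))%N.
Proof.
rewrite (cardsD1 e) in_symdiff addnC; congr (#|pred_of_set _| + _)%N.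
by apply/setP=> x; rewrite !inE; case: (x == e).
Qed.

Lemma setD1_notin e X : e \notin X -> X :\ e = X.
Proof.
move=> eX; apply/setP=> x; rewrite !inE.
by case: eqP => [->|//]; rewrite (negPf eX).
Qed.

Lemma etypeD1 D e F : F \in feasible D ->
  if e \in F then (etype D e (F :\ e)).2 else (etype D e (F :\ e)).1.
Proof.
move=> FD; case: ifP => eF; first by rewrite /= setD1K.
by rewrite /= setD1_notin ?eF.
Qed.

Lemma etypeD1_neq0 D e F : F \in feasible D -> etype D e (F :\ e) != ff.
Proof. by move/(@etypeD1 _ e); case: ifP; case: etype => [[] []]. Qed.

Lemma etype_feasible D e X : etype D e X != ff -> feasible D != set0.
Proof.
rewrite /etype => h; apply/set0Pn.
case: (boolP (X \in feasible D)) h => [XD _|_]; first by exists X.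
by case: (boolP (e |: X \in feasible D)) => // XD _; exists (e |: X).
Qed.

Lemma etype_sub D e X : proper_system D -> etype D e X != ff -> X \subset ground D.
Proof.
move=> pD; rewrite /etype.
case: (boolP (X \in feasible D)) => [/pD//|_].
case: (boolP (e |: X \in feasible D)) => // /pD h _.
by apply: subset_trans h; apply: subsetUr.
Qed.

(* The distances obtained by adding e to the first, second or third block.  The
   block is encoded by the vector of F_2^2 whose sets it puts one step further
   away: cval D e L c is the least #|symdiff X L| + (etype D e X == c) over the
   sets X with nonzero vector. *)
Definition cval D e L c : nat :=
  match c with
  | (true, false) => dist D (e |: L)
  | (false, true) => dist D L
  | _ => dist (dual_pivot1 D e) L
  end.

Lemma cval_le D e L c X : e \notin L -> c != ff -> e \notin X ->
  etype D e X != ff -> cval D e L c <= #|symdiff X L| + (etype D e X == c).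
Proof.
move=> eL c0 eX nX.
(* For a target without [e], only type (0,1) costs one extra step. The dual pivot reduces
   [c = (1,1)] to this case; for [c = (1,0)] the target contains [e] and the coordinates change
   roles. *)
have pos D' : etype D' e X != ff ->
    dist D' L <= #|symdiff X L| + (etype D' e X == (false, true)).
  rewrite /etype; case: (boolP (X \in _)) => [XD _|_]; first by rewrite addn0 dist_le.
  case: (boolP (_ \in _)) => // XD _; apply: leq_trans (dist_le _ XD) _.
  by rewrite (card_symdiffD1 e) setU1K ?setU11 ?(negPf eL) // setD1_notin.
case: c c0 => [[] []] //= _; last exact: pos.
- apply: leq_trans (pos _ _) _; rewrite etype_dual_pivot1 //;
  by case: etype nX => [[] []].
- move: nX; rewrite /etype; case: (boolP (e |: X \in _)) => [XD _|_].
    apply: leq_trans (dist_le _ XD) _.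
    by rewrite (card_symdiffD1 e) !setU1K ?setU11 //= addn0; lia.
  case: (boolP (X \in _)) => // XD _; apply: leq_trans (dist_le _ XD) _.
  by rewrite (card_symdiffD1 e) setU1K // setD1_notin // (negPf eX) setU11.
Qed.

Lemma cval_attained D e L c : e \notin L -> c != ff -> feasible D != set0 ->
  exists X, [/\ e \notin X, etype D e X != ff &
    #|symdiff X L| + (etype D e X == c) <= cval D e L c].
Proof.
move=> eL c0 nD.
have pos D' : feasible D' != set0 ->
    exists X, [/\ e \notin X, etype D' e X != ff &
    #|symdiff X L| + (etype D' e X == (false, true)) <= dist D' L].
  case/(dist_attained L)=> F FD <-; exists (F :\ e).
  split; rewrite ?setD11 ?etypeD1_neq0 //.
  rewrite (card_symdiffD1 e F) (setD1_notin eL) (negPf eL) addbF leq_add2l.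
  by have:= etypeD1 e FD; case: (e \in F); case: etype => [[] []].
case: c c0 => [[] []] //= _; last exact: pos.
- have [|X [eX nX le]] := pos (dual_pivot1 D e).
    have /set0Pn[F FD] := nD.
    have nz : etype (dual_pivot1 D e) e (F :\ e) != ff.
      rewrite etype_dual_pivot1 ?setD11 //.
      by case: etype (etypeD1_neq0 e FD) => [[] []].
    exact: etype_feasible nz.
  exists X; split=> //; move: nX le; rewrite etype_dual_pivot1 //;
  by case: etype => [[] []].
- have [F FD <-] := dist_attained (e |: L) nD; exists (F :\ e).
  split; rewrite ?setD11 ?etypeD1_neq0 //.
  rewrite (card_symdiffD1 e F) (setU1K eL) setU11 addbT leq_add2l.
  by have:= etypeD1 e FD; case: (e \in F); case: etype => [[] []].
Qed.

(* m is the least distance to L of a set of nonzero e-type; it is attained on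
   the type c0 only, and the other types start exactly at distance m + 1. *)
Definition tight D e L m c0 := c0 != ff /\ forall c, c != ff ->
  (forall X, e \notin X -> cross (etype D e X) c ->
     m + (c == c0) <= #|symdiff X L|) /\
  (exists X, [/\ e \notin X, cross (etype D e X) c &
     #|symdiff X L| <= m + (c == c0)]).

Lemma tight_feasible D e L m c0 : tight D e L m c0 -> feasible D != set0.
Proof.
case=> c0n /(_ _ c0n) [_ [X [_ + _]]].
by rewrite crossE => /and3P[/etype_feasible].
Qed.

(** Upper bound: the set of type other than [c] given by tightness pays no extra step. Lower bound:
    an attaining set either has type other than [c], where tightness applies, or has type [c] and
    pays the extra step itself. *)
Lemma tight_cval D e L m c0 c : e \notin L -> tight D e L m c0 -> c != ff ->
  cval D e L c = m + (c == c0).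
Proof.
move=> eL tD cn; have nD := tight_feasible tD; case: tD => c0n tD.
apply/eqP; rewrite eqn_leq; apply/andP; split.
  have [_ [X [eX + leX]]] := tD c cn; rewrite crossE => /and3P[nX _ Xc].
  by apply: leq_trans (cval_le eL cn eX nX) _; rewrite (negPf Xc) addn0.
have [X [eX nX]] := cval_attained eL cn nD; apply: leq_trans.
case: (eqVneq (etype D e X) c) => Xc; last first.
  by rewrite addn0; apply: (tD c cn).1 => //; rewrite crossE nX cn.
(* A nonzero vector other than [c]: a set of type [c] falls under the bound for [c'], hence lies at
   distance at least [m]. *)
pose c' := (c.2, c.1 (+) c.2).
have h : cross c c' by rewrite /c'; case: (c) cn => [[] []].
have c'n : c' != ff by move: h; rewrite crossE => /and3P[].
have := (tD c' c'n).1 X eX; rewrite Xc => /(_ h).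
by case: (c == c0); lia.
Qed.

Section TwoSum.
Variables (D1 D2 : set_system T) (e : T).
Hypothesis meet12 : ground D1 :&: ground D2 = [set e].

(** e-positive is (0,1), e-negative is (1,0), e-mixed is (1,1), and two nonzero vectors over F_2
    differ exactly when their determinant is 1. *)
Lemma same_etypeE F1 F2 : F1 \in feasible D1 -> F2 \in feasible D2 ->
  ~~ same_etype D1 D2 e F1 F2 =
  cross (etype D1 e (F1 :\ e)) (etype D2 e (F2 :\ e)).
Proof.
move=> F1D F2D.
rewrite /same_etype /e_positive /e_negative /e_mixed !symdiff1 /etype.
case: (boolP (e \in F1)) => e1; case: (boolP (e \in F2)) => e2;
  rewrite ?(setD1K e1) ?(setD1K e2) ?(setD1_notin e1) ?(setD1_notin e2) ?F1D ?F2D;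
  rewrite /cross /=; do 2 case: (_ \in feasible _) => //.
Qed.

Lemma two_sum_parts X1 X2 : X1 \subset ground D1 -> X2 \subset ground D2 ->
  ((X1 :|: X2) :\ e) :&: ground D1 = X1 :\ e.
Proof.
move=> /subsetP s1 /subsetP s2; apply/setP=> x; rewrite !inE.
case: (eqVneq x e) => //= xe.
move/setP/(_ x): (meet12); rewrite !inE (negPf xe).
have := s1 x; have := s2 x.
case: (x \in X1) => [_ /(_ isT) ->//|].
by case: (x \in X2) => [/(_ isT) -> _|//]; rewrite andbT => ->.
Qed.

End TwoSum.

Lemma mem_two_sum D1 D2 e Z : proper_system D1 -> proper_system D2 ->
  ground D1 :&: ground D2 = [set e] ->
  (Z \in feasible (two_sum D1 D2 e)) =
  (Z \subset (ground D1 :|: ground D2) :\ e) &&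
  cross (etype D1 e (Z :&: ground D1)) (etype D2 e (Z :&: ground D2)).
Proof.
move=> p1 p2 m12.
have m21 : ground D2 :&: ground D1 = [set e] by rewrite setIC.
apply/imsetP/andP => [[[F1 F2]]|[sZ cZ]].
  rewrite inE /= => /and3P[F1D F2D n12] ->; split.
    by apply: setSD; apply: setUSS; [apply: p1 | apply: p2].
  rewrite (two_sum_parts m12 (p1 _ F1D) (p2 _ F2D)) setUC.
  rewrite (two_sum_parts m21 (p2 _ F2D) (p1 _ F1D)).
  by rewrite -same_etypeE.
have eZ : e \notin Z by apply/negP=> /(subsetP sZ); rewrite setD11.
(* A nonzero vector has a feasible lift: add [e] whenever the result is feasible. *)
have choose D : exists2 F, F :\ e = Z :&: ground D &
    etype D e (Z :&: ground D) != ff -> F \in feasible D.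
  have eZD : e \notin Z :&: ground D by rewrite inE (negPf eZ).
  case: (boolP (e |: (Z :&: ground D) \in feasible D)) => h.
    by exists (e |: (Z :&: ground D)); rewrite ?setU1K.
  exists (Z :&: ground D); first by rewrite setD1_notin.
  by rewrite /etype (negPf h); case: (_ \in _).
have [F1 F1Z F1D] := choose D1; have [F2 F2Z F2D] := choose D2.
move: (cZ); rewrite crossE => /and3P[n1 n2 _].
exists (F1, F2).
  by rewrite inE /= F1D // F2D // same_etypeE ?F1D ?F2D // F1Z F2Z.
rewrite /= setDUl F1Z F2Z -setIUr; symmetry; apply/setIidPl.
by apply: subset_trans sZ _; apply: subsetDl.
Qed.

Lemma proper_two_sum D1 D2 e : proper_system D1 -> proper_system D2 ->
  proper_system (two_sum D1 D2 e).
Proof.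
move=> p1 p2 F /imsetP[[F1 F2]]; rewrite inE /= => /and3P[F1D F2D _] ->.
by apply: setSD; apply: setUSS; [apply: p1 | apply: p2].
Qed.

Lemma two_sumC D1 D2 e : proper_system D1 -> proper_system D2 ->
  ground D1 :&: ground D2 = [set e] -> two_sum D1 D2 e = two_sum D2 D1 e.
Proof.
move=> p1 p2 m12; apply: set_system_eq => [|Z] /=; first by rewrite setUC.
rewrite !mem_two_sum //; last by rewrite setIC.
rewrite setUC; congr (_ && _).
exact: crossC.
Qed.

(** For a part in [D1] of type [c1], the best partner in [D2] costs [m + (c1 == c)]; the remaining
    minimum over [D1] is the one described by [cval]. *)
Lemma dist_two_sum D1 D2 e L1 L2 m c :
  proper_system D1 -> proper_system D2 -> ground D1 :&: ground D2 = [set e] ->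
  L1 \subset ground D1 :\ e -> L2 \subset ground D2 :\ e ->
  feasible D1 != set0 -> tight D2 e L2 m c ->
  dist (two_sum D1 D2 e) (L1 :|: L2) = m + cval D1 e L1 c.
Proof.
move=> p1 p2 m12 sL1 sL2 nD1 [c0 t2].
have eL1 : e \notin L1 by apply/negP=> /(subsetP sL1); rewrite setD11.
(* Off [e] the two ground sets are disjoint, so distances add up. *)
have cardZ Z : Z \subset (ground D1 :|: ground D2) :\ e ->
    #|symdiff Z (L1 :|: L2)| =
    #|symdiff (Z :&: ground D1) L1| + #|symdiff (Z :&: ground D2) L2|.
  move=> /subsetP sZ; rewrite -cardsUI.
  have key x : [/\ x \in L1 -> (x \in ground D1) && (x \notin ground D2),
      x \in L2 -> (x \in ground D2) && (x \notin ground D1)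
    & x \in Z -> (x \in ground D1) (+) (x \in ground D2)].
    have := sZ x; have := subsetP sL1 x; have := subsetP sL2 x.
    move/setP/(_ x): (m12); rewrite !inE; case: (x == e) => /=.
      by move=> _ h2 h1 h3; split=> [/h1|/h2|/h3].
    case: (x \in ground D1); case: (x \in ground D2) => //= _ h2 h1 h3;
    by split=> [/h1|/h2|/h3].
  have -> : symdiff (Z :&: ground D1) L1 :&: symdiff (Z :&: ground D2) L2 = set0.
    apply/setP=> x; rewrite in_set0 in_setI !in_symdiff !in_setI.
    have [] := key x; case: (x \in L1) => [/(_ isT)/andP[-> /negPf->]|_];
    case: (x \in L2) => [/(_ isT)/andP[// -> /negPf->]|_];
    case: (x \in Z) => [/(_ isT)|_] //=; by do 2 case: (x \in ground _).
  rewrite cards0 addn0; apply: eq_card => x.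
  rewrite in_setU !in_symdiff in_setU !in_setI.
  have [] := key x; case: (x \in L1) => [/(_ isT)/andP[-> /negPf->]|_];
  case: (x \in L2) => [/(_ isT)/andP[// -> /negPf->]|_];
  case: (x \in Z) => [/(_ isT)|_] //=; by do 2 case: (x \in ground _).
apply: dist_eq.
  (* Upper bound: [X1] attains [cval], and [X2] is a cheapest partner for its type. *)
  have [X1 [eX1 n1 le1]] := cval_attained eL1 c0 nD1.
  have [_ [X2 [eX2 cX le2]]] := t2 _ n1.
  have s1 := etype_sub p1 n1.
  have n2 : etype D2 e X2 != ff by move: cX; rewrite crossE => /and3P[].
  have s2 := etype_sub p2 n2.
  have eX : e \notin X1 :|: X2 by rewrite inE negb_or eX1.
  have sX : X1 :|: X2 \subset (ground D1 :|: ground D2) :\ e.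
    by rewrite subsetD1 eX andbT setUSS.
  have e1 : (X1 :|: X2) :&: ground D1 = X1.
    by rewrite -{1}(setD1_notin eX) (two_sum_parts m12) // setD1_notin.
  have e2 : (X1 :|: X2) :&: ground D2 = X2.
    rewrite setUC in eX *.
    rewrite -{1}(setD1_notin eX) (two_sum_parts _ s2 s1) ?setD1_notin //.
    by rewrite setIC.
  exists (X1 :|: X2).
    by rewrite mem_two_sum // sX e1 e2 /= crossC.
  rewrite cardZ // e1 e2 addnC; apply: leq_trans (leq_add le2 (leqnn _)) _.
  by rewrite -addnA leq_add2l addnC.
move=> Z; rewrite mem_two_sum // => /andP[sZ cZ]; rewrite cardZ //.
have eZ : e \notin Z by apply/negP=> /(subsetP sZ); rewrite setD11.
move: (cZ); rewrite crossE => /and3P[n1 n2 n12].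
have e1 : e \notin Z :&: ground D1 by rewrite inE (negPf eZ).
have e2 : e \notin Z :&: ground D2 by rewrite inE (negPf eZ).
have := cval_le eL1 c0 e1 n1.
have := (t2 _ n1).1 _ e2; rewrite crossC cZ => /(_ isT) le2 le1.
rewrite [X in _ <= X]addnC; apply: leq_trans (leq_add le2 (leqnn _)).
by rewrite -addnA leq_add2l addnC.
Qed.

End Distances.

(** * Exchange arguments *)

Section Tightness.
Variable T : finType.
Implicit Types (D : set_system T) (A F L N X Y Z : {set T}) (e x : T).
Implicit Types (b c : bool * bool).

(** An element of [D1] other than [e] lies outside [D2], so a dual pivot there changes only the
    first argument of the determinant, and linearly. *)
Lemma dual_pivot_two_suml D1 D2 e N : proper_system D1 -> proper_system D2 ->
  ground D1 :&: ground D2 = [set e] -> N \subset ground D1 :\ e ->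
  dual_pivot (two_sum D1 D2 e) N = two_sum (dual_pivot D1 N) D2 e.
Proof.
move=> p1 p2 m12 /subsetP sN; rewrite /dual_pivot.
have: {subset enum N <= ground D1 :\ e} by move=> x; rewrite mem_enum; apply: sN.
elim: (enum N) D1 p1 m12 {sN} => //= x s IH D1 p1 m12 sE.
have /setD1P[xe x1] := sE x (mem_head _ _).
have x2 : x \notin ground D2.
  by apply/negP=> x2; move/setP/(_ x): m12; rewrite !inE x1 x2 (negPf xe).
have p1' : proper_system (dual_pivot1 D1 x).
  have := @proper_dual_pivot _ D1 [set x]; rewrite /dual_pivot enum_set1 /=.
  by apply; rewrite ?sub1set.
rewrite -IH // => [|y ys]; last by apply: sE; rewrite inE ys orbT.
congr foldl; apply: set_system_eq => // Z.
rewrite mem_dual_pivot1 !mem_two_sum //= etype_dual_pivot1_neq //.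
have -> : (x |: Z) :&: ground D1 = x |: (Z :&: ground D1).
  by apply/setP=> y; rewrite !inE; case: eqP => // ->; rewrite x1.
have -> : (x |: Z) :&: ground D2 = Z :&: ground D2.
  by apply/setP=> y; rewrite !inE; case: eqP => // ->; rewrite (negPf x2) !andbF.
rewrite subUset sub1set !inE xe x1 /= andbT.
by case: (Z \subset _) => //=; rewrite andbF.
Qed.

Lemma dual_pivot_two_sum D1 D2 e N1 N2 : proper_system D1 -> proper_system D2 ->
  ground D1 :&: ground D2 = [set e] ->
  N1 \subset ground D1 :\ e -> N2 \subset ground D2 :\ e ->
  dual_pivot (two_sum D1 D2 e) (N1 :|: N2) =
  two_sum (dual_pivot D1 N1) (dual_pivot D2 N2) e.
Proof.
move=> p1 p2 m12 sN1 sN2; rewrite dual_pivotU; last first.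
  rewrite -setI_eq0; apply/eqP/setP=> x; rewrite !inE; apply/negP=> /andP[x1 x2].
  have /setD1P[xe {}x1] := subsetP sN1 x x1; have /setD1P[_ {}x2] := subsetP sN2 x x2.
  by move/setP/(_ x): m12; rewrite !inE x1 x2 (negPf xe).
have pN1 : proper_system (dual_pivot D1 N1).
  by apply: proper_dual_pivot => //; apply: subset_trans sN1 (subsetDl _ _).
have pN2 : proper_system (dual_pivot D2 N2).
  by apply: proper_dual_pivot => //; apply: subset_trans sN2 (subsetDl _ _).
rewrite dual_pivot_two_suml // two_sumC ?ground_dual_pivot //.
rewrite dual_pivot_two_suml // ?ground_dual_pivot 1?setIC //.
by rewrite two_sumC ?ground_dual_pivot // setIC.
Qed.

(** Exchange moves [X] towards [Y] within the sets of least size: an element of [X :\: Y] is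
    replaced by one of [Y :\: X] until [X = Y]. *)
Lemma exchange_min_etype D e m X Y : delta_matroid D ->
  (forall F, F \in feasible D -> m <= #|F :\ e|) ->
  e \notin X -> e \notin Y -> X \in feasible D -> e |: Y \in feasible D ->
  #|X| = m -> #|Y| = m -> Y \in feasible D.
Proof.
case=> _ _ exch lb eX eY XD YD cX cY.
have [k] := ubnP #|X :\: Y|; elim: k X eX XD cX => // k IH X eX XD cX leXY.
have [/eqP|[u]] := set_0Vmem (X :\: Y).
  by rewrite setD_eq0 => sXY; have /eqP <- : X == Y by rewrite eqEcard sXY cX cY /=.
rewrite inE => /andP[uY uX].
have ue : u != e by apply: contraNneq eX => <-.
have uXY : u \in symdiff X (e |: Y) by rewrite !inE uX (negPf uY) (negPf ue).
have [v] := exch _ _ _ XD YD uXY; rewrite in_symdiff in_setU1 => vXY FD.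
have card_u : #|X :\ u| < m by rewrite -cX (cardsD1 u X) uX.
(* Otherwise the new set would, off [e], have fewer than [m] elements. This excludes [v] in [X] and
   [v = e], leaving [v] in [Y] but not in [X]. *)
have small : ~~ (symdiff X [set u; v] :\ e \subset X :\ u).
  apply/negP=> /subset_leq_card le; have := lb _ FD.
  by rewrite leqNgt (leq_ltn_trans le).
have [vX|vX] := boolP (v \in X).
  case/negP: small; apply/subsetP=> y; rewrite !in_setD1 in_symdiff in_set2.
  case: (eqVneq y u) => [->|_]; first by rewrite uX /= andbF.
  by case: (eqVneq y v) => [->|_] /=; rewrite ?vX ?addbF => /andP[].
move: vXY; rewrite (negPf vX) /= => /orP[/eqP ve|vY].
  case/negP: small; apply/subsetP=> y; rewrite ve !in_setD1 in_symdiff in_set2.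
  case: (eqVneq y u) => [->|_]; first by rewrite uX /= andbF.
  by case: (eqVneq y e) => //= _; rewrite addbF.
have vu : v != u by apply: contraNneq vX => ->.
have FE : symdiff X [set u; v] = v |: (X :\ u).
  apply/setP=> y; rewrite in_setU1 in_setD1 in_symdiff in_set2.
  case: (eqVneq y u) => [->|_]; first by rewrite uX eq_sym (negPf vu).
  by case: (eqVneq y v) => [->|_]; rewrite ?(negPf vX) ?addbF.
apply: (IH (v |: (X :\ u))).
- rewrite !inE negb_or (negPf eX) andbF andbT.
  by apply: contraNneq eY => ->.
- by rewrite -FE.
- by rewrite cardsU1 !inE (negPf vX) andbF -cX (cardsD1 u X) uX.
- rewrite -ltnS; apply: leq_trans leXY; rewrite ltnS; apply: proper_card.
  apply/properP; split.
    apply/subsetP=> y; rewrite !in_setD in_setU1 in_setD1.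
    case: (eqVneq y v) => [->|_ /=]; first by rewrite vY.
    by case/and3P=> -> _ ->.
  by exists u; rewrite !in_setD ?uY ?uX // in_setU1 in_setD1 eqxx eq_sym (negPf vu) andbF.
Qed.

(** Exchange at [e] between [X] and [e |: X0]: the partner [v] is not [e], as [e |: X] is
    infeasible, so the new set contains [e] and otherwise differs from [X] in [v] only. *)
Lemma exchange_into D e X X0 : delta_matroid D -> e \notin X -> e \notin X0 ->
  etype D e X = (true, false) -> (etype D e X0).2 ->
  exists X', [/\ e \notin X', (etype D e X').2 & #|X'| <= #|X|.+1].
Proof.
case=> _ _ exch eX eX0 [XD XeD] X0D.
have eXY : e \in symdiff X (e |: X0) by rewrite !inE eqxx (negPf eX).
have [v] := exch _ _ _ XD X0D eXY.
have [-> _|ve _ FD] := eqVneq v e; first by rewrite setUid symdiff1 (negPf eX) XeD.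
exists (symdiff X [set e; v] :\ e).
have eF : e \in symdiff X [set e; v] by rewrite !inE eqxx (negPf eX).
split; rewrite ?setD11 //= ?setD1K //.
apply: leq_trans (_ : #|v |: X| <= _); last by rewrite cardsU1; case: (_ \notin _).
apply: subset_leq_card; apply/subsetP=> y; rewrite !inE.
by case: (eqVneq y e) => //=; case: (y \in X); case: (y == v).
Qed.

(* None of the three F_2-linear functionals vanishes identically on e-types. *)
Definition nonsingular D e := forall c, c != ff ->
  exists2 X : {set T}, e \notin X & cross (etype D e X) c.

(** A functional vanishing on all vectors is a form of singularity: [b.1] for a coloop, [b.2] for a
    loop, [b.1 (+) b.2] when [e] can always be toggled. *)
Lemma nonsingularP D e : ~~ singular D e -> nonsingular D e.
Proof.
rewrite !negb_or /coloop /loop !negb_forall => /and3P[].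
move=> /existsP[F1]; rewrite negb_imply => /andP[F1D e1].
move=> /existsP[F2]; rewrite negb_imply negbK => /andP[F2D e2].
move=> /existsP[F3]; rewrite negb_imply symdiff1 => /andP[F3D e3].
case=> [[] []] // _.
- exists (F3 :\ e); rewrite ?setD11 // /cross /=.
  case: ifP e3 => eF /negPf e3; first by rewrite setD1K // F3D e3.
  by rewrite setD1_notin ?eF // F3D e3.
- by exists (F2 :\ e); rewrite ?setD11 // /cross /= setD1K // F2D andbF.
- by exists F1; rewrite // /cross /= F1D andbF.
Qed.

Lemma nonsingular_dual_pivot D e N :
  e \notin N -> nonsingular D e -> nonsingular (dual_pivot D N) e.
Proof.
move=> eN nsD; apply: (dual_pivot_ind (P := nonsingular^~ e)) => // D' x ns xN.
have xe : x != e by apply: contraNneq eN => <-.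
move=> c c0; have [X eX cX] := ns c c0.
(* If the value at [x |: X] cancels the one at [X], then [x |: X] is a witness, since its own value
   is unchanged. *)
case: (boolP ((x \notin X) && cross (etype D' e (x |: X)) c)) => h; last first.
  by exists X; rewrite // etype_dual_pivot1_neq // cX (negPf h).
case/andP: h => xX h; exists (x |: X); first by rewrite !inE negb_or eq_sym xe.
by rewrite etype_dual_pivot1_neq // setU11 h.
Qed.

Lemma symdiffs0 A : symdiff A set0 = A.
Proof. by apply/setP=> x; rewrite in_symdiff inE addbF. Qed.

Lemma nonsingular_twist D e L :
  e \notin L -> nonsingular D e -> nonsingular (twist D L) e.
Proof.
move=> eL ns c c0; have [X eX cX] := ns c c0; exists (symdiff X L).
  by rewrite in_symdiff (negPf eX).
by rewrite etype_twist // symdiffK.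
Qed.

(** Twisting by [L] turns distance to [L] into cardinality, so the exchange arguments need only
    minimise sizes. *)
Lemma tight_twist D e L m c0 :
  e \notin L -> tight (twist D L) e set0 m c0 -> tight D e L m c0.
Proof.
move=> eL [c0n tD]; split=> // c cn; have [lb [X [eX cX le]]] := tD c cn.
split=> [Y eY cY|].
  rewrite -(symdiffs0 (symdiff Y L)); apply: lb.
    by rewrite in_symdiff (negPf eY).
  by rewrite etype_twist // symdiffK.
exists (symdiff X L); split; first by rewrite in_symdiff (negPf eX).
  by rewrite -etype_twist.
by rewrite symdiffK -(symdiffs0 X).
Qed.

Lemma etype_twist1 D e X : e \notin X ->
  etype (twist D [set e]) e X = ((etype D e X).2, (etype D e X).1).
Proof.
by move=> eX; rewrite /etype !mem_twist !symdiff1 (negPf eX) setU11 setU1K.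
Qed.

Lemma tight_delta_matroid D e : delta_matroid D ->
  delta_matroid (dual_pivot1 D e) -> delta_matroid (loop_compl D e) ->
  delta_matroid (twist D [set e]) -> nonsingular D e ->
  exists m c0, tight D e set0 m c0.
Proof.
move=> dD dP dL dT ns.
have [F0 F0D] : exists F, F \in feasible D by case: dD => /set0Pn.
have [F FD lbF] := arg_minnP (fun F => #|F :\ e|) F0D.
have {}lbF G : G \in feasible D -> #|F :\ e| <= #|G :\ e| by apply: lbF.
pose X := F :\ e; pose m := #|X|; pose c0 := etype D e X.
have eX : e \notin X by rewrite setD11.
have c0n : c0 != ff by apply: etypeD1_neq0.
have lbP F' : F' \in feasible (dual_pivot1 D e) -> m <= #|F' :\ e|.
  rewrite mem_dual_pivot1; case: (boolP (F' \in feasible D)) => [/lbF//|_] /=.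
  by case/andP=> eF' /lbF; rewrite setU1K // (setD1_notin eF').
have lb Y : e \notin Y -> etype D e Y != ff -> m <= #|Y|.
  rewrite /etype => eY; case: (boolP (Y \in _)) => [/lbF|_].
    by rewrite (setD1_notin eY).
  by case: (boolP (_ \in _)) => // /lbF; rewrite setU1K.
(* At size [m], type (0,1) cannot coexist with (1,0) or (1,1). The same fact for the dual pivot,
   which fixes (1,0) and swaps the other two, gives [mixed]; together they leave a single type. *)
have pos Y Z : e \notin Y -> e \notin Z -> #|Y| = m -> #|Z| = m ->
    (etype D e Y).1 -> etype D e Z != (false, true).
  move=> eY eZ cY cZ YD; apply/eqP=> -[ZD ZeD].
  by rewrite (exchange_min_etype dD lbF eY eZ YD ZeD cY cZ) in ZD.
have mixed Y Z : e \notin Y -> e \notin Z -> #|Y| = m -> #|Z| = m ->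
    etype D e Y = (true, false) -> etype D e Z != (true, true).
  move=> eY eZ cY cZ YD; apply/eqP=> ZD.
  have := etype_dual_pivot1 D eY; rewrite YD => -[YP _].
  have := etype_dual_pivot1 D eZ; rewrite ZD => -[ZP ZeP].
  by rewrite (exchange_min_etype dP lbP eY eZ YP ZeP cY cZ) in ZP.
have uniq Y : e \notin Y -> etype D e Y != ff -> #|Y| = m -> etype D e Y = c0.
  move=> eY nY cY; have p1 := pos X Y eX eY erefl cY; have p2 := pos Y X eY eX cY erefl.
  have p3 := mixed X Y eX eY erefl cY; have p4 := mixed Y X eY eX cY erefl.
  rewrite /c0 in c0n *; move: nY c0n p1 p2 p3 p4.
  case: (etype D e X) => [[] []]; case: (etype D e Y) => [[] []] //= _ _ p1 p2 p3 p4;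
  by [have := p1 isT|have := p2 isT|have := p3 erefl|have := p4 erefl].
(* [exchange_into] starts from type (1,0). Loop complement brings (1,1) there and the twist brings
   (0,1) there; each time the second coordinate becomes the functional of [c0]. *)
have [X' [eX' cX' leX']] :
    exists X', [/\ e \notin X', cross (etype D e X') c0 & #|X'| <= m.+1].
  have [X0 eX0 cX0] := ns c0 c0n; move: c0n cX0; rewrite /m.
  case c0E: c0 => [[] []] // _ cX0.
  - have := @exchange_into (loop_compl D e) e X X0 dL eX eX0.
    rewrite !etype_loop_compl // -/c0 c0E => /(_ erefl) [|X' [eX' cX' le]].
      by move: cX0; rewrite /cross /= !andbT.
    exists X'; split=> //; move: cX'; rewrite etype_loop_compl //.
    by rewrite /cross /= !andbT.
  - have := @exchange_into D e X X0 dD eX eX0; rewrite -/c0 c0E.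
    case/(_ erefl) => [|X' [eX' cX' le]].
      by move: cX0; rewrite /cross /= andbT andbF.
    by exists X'; split=> //; move: cX'; rewrite /cross /= andbT andbF.
  - have := @exchange_into (twist D [set e]) e X X0 dT eX eX0.
    rewrite !etype_twist1 // -/c0 c0E => /(_ erefl) [|X' [eX' cX' le]].
      by move: cX0; rewrite /cross /= andbT andbF addbF.
    exists X'; split=> //; move: cX'; rewrite etype_twist1 //.
    by rewrite /cross /= andbT andbF addbF.
exists m, c0; split=> // c cn; split=> [Y eY|].
  rewrite crossE symdiffs0 => /and3P[nY _ Yc]; have leY := lb Y eY nY.
  have [cc0|] := eqVneq c c0; last by rewrite addn0.
  rewrite addn1 ltn_neqAle leY andbT; apply: contraNneq Yc => mY.
  by rewrite cc0; apply/eqP/uniq.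
(* For [c = c0] the witness is [X'], of size at most [m + 1]; any other [c] is crossed by the
   minimiser [X]. *)
have [->|cc0] := eqVneq c c0.
  by exists X'; split; rewrite // symdiffs0 addn1.
by exists X; split; rewrite // ?crossE -/c0 ?c0n ?cn 1?eq_sym // symdiffs0 addn0.
Qed.

Lemma vf_safe_proper D : vf_safe D -> proper_system D.
Proof. by move/(_ D (vf_refl D)) => []. Qed.

Lemma vf_safe_feasible D : vf_safe D -> feasible D != set0.
Proof. by move/(_ D (vf_refl D)) => []. Qed.

Lemma reachable_dual_pivot1 D D' x :
  vf_reachable D D' -> x \in ground D' -> vf_reachable D (dual_pivot1 D' x).
Proof.
move=> r xD'; apply: vf_loop_compl => //; apply: vf_twist; last by rewrite sub1set.
exact: vf_loop_compl.
Qed.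

Lemma reachable_dual_pivot D N :
  N \subset ground D -> vf_reachable D (dual_pivot D N).
Proof.
move=> sN; pose P D' := vf_reachable D D' /\ ground D' = ground D.
suff [] : P (dual_pivot D N) by [].
apply: dual_pivot_ind; first by split; first apply: vf_refl.
move=> D' x [r gD'] xN; split=> //; apply: reachable_dual_pivot1 => //.
by rewrite gD' (subsetP sN).
Qed.

(** Dual pivoting [N], twisting by [L] and then acting at [e] stays among the systems reachable from
    [D], which are delta-matroids. *)
Lemma vf_safe_tight D e L N : vf_safe D -> e \in ground D -> ~~ singular D e ->
  L \subset ground D :\ e -> N \subset ground D :\ e ->
  exists m c0, tight (dual_pivot D N) e L m c0.
Proof.
move=> vf eD ns sL sN.
have notin A : A \subset ground D :\ e -> e \notin A.
  by move=> sA; apply/negP=> /(subsetP sA); rewrite setD11.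
have r : vf_reachable D (twist (dual_pivot D N) L).
  apply: vf_twist; last by rewrite ground_dual_pivot (subset_trans sL) ?subsetDl.
  by apply: reachable_dual_pivot; rewrite (subset_trans sN) ?subsetDl.
have er : e \in ground (twist (dual_pivot D N) L) by rewrite /= ground_dual_pivot.
have [||||| m [c0 t]] := @tight_delta_matroid (twist (dual_pivot D N) L) e.
- exact: vf.
- exact/vf/reachable_dual_pivot1.
- exact/vf/vf_loop_compl.
- by apply/vf/vf_twist; rewrite ?sub1set.
- apply: nonsingular_twist; first exact: notin.
  by apply: nonsingular_dual_pivot; [exact: notin | exact: nonsingularP].
by exists m, c0; apply: tight_twist t; apply: notin.
Qed.

End Tightness.

(** * Sums over ordered partitions *)

Section Partitions.
Variable T : finType.
Implicit Types (A B L M N : {set T}) (P : {set T} * {set T} * {set T}) (x : T).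

(** Counting blocks pointwise reduces identities between partitions to Boolean case analysis. *)
Lemma ordered_partition3P A P : reflect
  (forall x, if x \in A
     then (x \in P.1.1) + (x \in P.1.2) + (x \in P.2) = 1
     else (x \in P.1.1) + (x \in P.1.2) + (x \in P.2) = 0)
  (ordered_partition3 A P).
Proof.
case: P => [[L M] N] /=; rewrite -!setI_eq0.
apply: (iffP and4P) => [[/eqP <- /eqP/setP d1 /eqP/setP d2 /eqP/setP d3] x|h].
  move: (d1 x) (d2 x) (d3 x); rewrite !inE.
  by case: (x \in L); case: (x \in M); case: (x \in N).
by split; apply/eqP/setP=> x; move: (h x); rewrite !inE;
  case: (x \in A); case: (x \in L); case: (x \in M); case: (x \in N).
Qed.

Lemma ordered_partition3_sub A P :
  ordered_partition3 A P -> (P.1.1 \subset A) && (P.2 \subset A).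
Proof.
move/ordered_partition3P=> h; apply/andP; split; apply/subsetP=> x xP;
by move: (h x); rewrite xP; case: (x \in A) => //; rewrite ?addnS.
Qed.

Definition union3 P1 P2 : {set T} * {set T} * {set T} :=
  (P1.1.1 :|: P2.1.1, P1.1.2 :|: P2.1.2, P1.2 :|: P2.2).

Variable R : comNzRingType.
Local Open Scope ring_scope.
Implicit Types (F : {set T} * {set T} * {set T} -> R) (U V W : T -> R).

Lemma sum_partition3U A B F : [disjoint A & B] ->
  \sum_(P | ordered_partition3 (A :|: B) P) F P =
  \sum_(P1 | ordered_partition3 A P1) \sum_(P2 | ordered_partition3 B P2)
    F (union3 P1 P2).
Proof.
move=> dAB; have {dAB} dAB x : (x \in A) && (x \in B) = false.
  by case: (boolP (x \in A)) => // xA; rewrite (disjointFr dAB xA).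
(* Inverse of [union3]: the blocks are intersected with each of the two sets. *)
pose cut C P := (P.1.1 :&: C, P.1.2 :&: C, P.2 :&: C).
rewrite pair_big (reindex_onto (fun PP => union3 PP.1 PP.2)
  (fun P => (cut A P, cut B P))); last first.
  move=> [[L M] N] /ordered_partition3P h; congr (_, _, _); apply/setP=> x;
  by move: (h x); rewrite !inE; do 2 case: (x \in _); case: (x \in L);
     case: (x \in M); case: (x \in N).
apply: eq_bigl => -[[[L1 M1] N1] [[L2 M2] N2]].
apply/andP/andP => [[/ordered_partition3P h /eqP[/setP e1 /setP e2 /setP e3
    /setP e4 /setP e5 /setP e6]]|[/ordered_partition3P h1 /ordered_partition3P h2]].
  split; apply/ordered_partition3P=> x; move: (h x) (dAB x) (e1 x) (e2 x) (e3 x);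
  move: (e4 x) (e5 x) (e6 x); rewrite /= !inE; do 8 case: (x \in _) => //=.
split.
  apply/ordered_partition3P=> x; move: (dAB x) (h1 x) (h2 x); rewrite /= !inE.
  by do 8 case: (x \in _) => //=.
apply/eqP; congr (_, _, _, (_, _, _)); apply/setP=> x;
  move: (dAB x) (h1 x) (h2 x); rewrite /= !inE; by do 8 case: (x \in _) => //=.
Qed.

Lemma sum_partition3_1 e F :
  \sum_(P | ordered_partition3 [set e] P) F P =
  F ([set e], set0, set0) + F (set0, [set e], set0) + F (set0, set0, [set e]).
Proof.
have op (P : {set T} * {set T} * {set T}) : ordered_partition3 [set e] P =
    (P \in [:: ([set e], set0, set0); (set0, [set e], set0); (set0, set0, [set e])]).
  apply/idP/idP => [/ordered_partition3P|].
    case: P => [[L M] N] /= h.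
    have val (C : {set T}) : (forall x, x != e -> x \notin C) ->
        C = if e \in C then [set e] else set0.
      move=> eC; apply/setP=> x; case: ifP => ec; rewrite !inE;
      by case: (eqVneq x e) => [->|/eC/negPf].
    have -> := val L; last first.
      by move=> x xe; move: (h x); rewrite inE (negPf xe); case: (_ \in _).
    have -> := val M; last first.
      by move=> x xe; move: (h x); rewrite inE (negPf xe); do 2 case: (_ \in _).
    have -> := val N; last first.
      by move=> x xe; move: (h x); rewrite inE (negPf xe); do 3 case: (_ \in _).
    by move: (h e); rewrite set11; do 3 case: (e \in _) => //=; rewrite !inE eqxx ?orbT.
  rewrite !inE => /or3P[] /eqP->; apply/ordered_partition3P=> x;
  by rewrite /= !inE; case: (x == e).
have uniq3 : uniq
    [:: ([set e], set0, set0); (set0, [set e], set0); (set0, set0, [set e])].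
  rewrite /= !inE !xpair_eqE !andbT.
  have ne : ([set e] == set0) = false by rewrite -cards_eq0 cards1.
  by rewrite ![set0 == _]eq_sym ne ?andbF.
rewrite (eq_bigl _ _ op) -big_uniq //= !big_cons big_nil addr0 addrA //.
Qed.

Definition weight U V W P : R :=
  (\prod_(e in P.1.1) U e) * (\prod_(e in P.1.2) V e) * (\prod_(e in P.2) W e).

Lemma weight_union3 U V W A B P1 P2 : [disjoint A & B] ->
  ordered_partition3 A P1 -> ordered_partition3 B P2 ->
  weight U V W (union3 P1 P2) = weight U V W P1 * weight U V W P2.
Proof.
move=> dAB /ordered_partition3P h1 /ordered_partition3P h2.
have prodU (C1 C2 : {set T}) G : C1 \subset A -> C2 \subset B ->
    \prod_(e in C1 :|: C2) G e = (\prod_(e in C1) G e) * \prod_(e in C2) G e :> R.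
  move=> s1 s2; rewrite -bigU ?(disjointWl s1 (disjointWr s2 dAB)) //=.
  by apply: eq_bigl => x; rewrite !inE.
rewrite /weight !prodU; first by ring.
all: apply/subsetP=> x xP; move: (h1 x) (h2 x); rewrite xP;
  by do 7 ?case: (x \in _) => //=.
Qed.

Lemma eq_weight U V W U' V' W' A P : ordered_partition3 A P ->
  {in A, U =1 U'} -> {in A, V =1 V'} -> {in A, W =1 W'} ->
  weight U V W P = weight U' V' W' P.
Proof.
move=> /ordered_partition3P h hU hV hW; rewrite /weight.
congr (_ * _ * _); apply: eq_bigr => x xP; [apply: hU | apply: hV | apply: hW];
by move: (h x); rewrite xP; case: (x \in A); rewrite ?addnS.
Qed.

End Partitions.

Lemma mem_imset_on (T S : finType) (phi : T -> S) (A L : {set T}) x :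
  {in A &, injective phi} -> L \subset A -> x \in A ->
  (phi x \in phi @: L) = (x \in L).
Proof.
move=> inj sL xA; apply/imsetP/idP => [[y yL xy]|xL]; last by exists x.
by rewrite (inj x y xA (subsetP sL y yL) xy).
Qed.

Lemma sum_partition3_imset (R : comNzRingType) (T S : finType) (phi : T -> S)
    (A : {set T})
    (F : {set S} * {set S} * {set S} -> R) : {in A &, injective phi} ->
  (\sum_(K | ordered_partition3 (phi @: A) K) F K)%R =
  (\sum_(P | ordered_partition3 A P)
    F (phi @: P.1.1, phi @: P.1.2, phi @: P.2))%R.
Proof.
(* [phi] is injective only on [A], so preimages are cut down to [A]. *)
move=> inj; pose back (C : {set S}) := A :&: phi @^-1: C.
rewrite (reindex_onto
  (fun P : {set T} * {set T} * {set T} =>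
     (phi @: P.1.1, phi @: P.1.2, phi @: P.2))
  (fun K => (back K.1.1, back K.1.2, back K.2))); last first.
  have backK (C : {set S}) : C \subset phi @: A -> phi @: back C = C.
    move=> sC; apply/setP=> y; apply/imsetP/idP => [[x]|yC].
      by rewrite !inE => /andP[_ xC] ->.
    have /imsetP[x xA yx] := subsetP sC y yC.
    by exists x; rewrite // !inE xA -yx.
  move=> [[L M] N] /ordered_partition3P h; congr (_, _, _); apply: backK;
  by apply/subsetP=> y yC; move: (h y); rewrite /= yC; do 3 case: (_ \in _) => //.
apply: eq_bigl => -[[L M] N]; apply/andP/idP => [[]|/ordered_partition3P h].
  move=> /ordered_partition3P h /eqP[eL eM eN].
  have sub (C : {set T}) : back (phi @: C) = C -> C \subset A.
    by move=> <-; apply: subsetIl.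
  apply/ordered_partition3P=> x; case: ifP => xA.
    by have:= h (phi x); rewrite (imset_f phi xA) /= !(mem_imset_on inj _ xA) ?sub.
  have notin (C : {set T}) : back (phi @: C) = C -> x \in C = false.
    by move=> /sub/subsetP sC; apply/negP=> /sC; rewrite xA.
  by rewrite /= !notin.
have sub (C : {set T}) : C \in [:: L; M; N] -> C \subset A.
  move=> CP; apply/subsetP=> x xC; move: (h x) CP; rewrite /= !inE.
  case: (x \in A) => //= xP /or3P[] /eqP Ceq; move: xP; rewrite -Ceq xC;
  by do 2 case: (_ \in _).
have sL : L \subset A by apply: sub; rewrite inE eqxx.
have sM : M \subset A by apply: sub; rewrite !inE eqxx orbT.
have sN : N \subset A by apply: sub; rewrite !inE eqxx !orbT.
split.
  apply/ordered_partition3P=> y; case: ifP => [/imsetP[x xA ->]|yA] /=.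
    by rewrite !(mem_imset_on inj) //; have := h x; rewrite xA.
  have notin (C : {set T}) : C \subset A -> y \in phi @: C = false.
    by move=> sC; apply/negP=> /(subsetP (imsetS phi sC)); rewrite yA.
  by rewrite !notin.
have imK (C : {set T}) : C \subset A -> back (phi @: C) = C.
  move=> sC; apply/setP=> x; rewrite !inE.
  case: (boolP (x \in A)) => xA /=; first by rewrite (mem_imset_on inj).
  by apply/esym/negP=> /(subsetP sC); rewrite (negPf xA).
by rewrite /= !imK.
Qed.


(** * Transition sums of two-sums and of minors *)

Section TransitionSums.
Variables (T : finType) (R : comNzRingType).
Local Open Scope ring_scope.
Implicit Types (D : set_system T) (A L N : {set T}) (e x : T).
Implicit Types (U V W : T -> R) (t : R) (c : bool * bool).

(** The transition polynomial with weights in any commutative ring, so that substitutions and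
    renamings become changes of weights. *)
Definition Qsum U V W t D : R :=
  \sum_(P | ordered_partition3 (ground D) P)
    weight U V W P * t ^+ dist (dual_pivot D P.2) P.1.1.

(** Under tightness just one of the three distances is [m + 1] and the others are [m], so two of
    them determine [m]. *)
Definition mval D e L : nat :=
  minn (cval D e L (true, false)) (cval D e L (false, true)).

(* Part of the sum over the partitions of ground D :\ e where c is the vector
   attaining the least distance.  For c = (1,0), (0,1), (1,1) these are the
   polynomials p, q, r of the theorem. *)
Definition Qtype U V W t D e c : R :=
  \sum_(P | ordered_partition3 (ground D :\ e) P)
    weight U V W P *
    (t ^+ mval (dual_pivot D P.2) e P.1.1 *+
      (cval (dual_pivot D P.2) e P.1.1 c == (mval (dual_pivot D P.2) e P.1.1).+1)).

Definition tight_at D e := forall L N,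
  L \subset ground D :\ e -> N \subset ground D :\ e ->
  exists m c0, tight (dual_pivot D N) e L m c0.

Lemma tight_mval D e L m c0 : e \notin L -> tight D e L m c0 -> mval D e L = m.
Proof.
move=> eL tD; rewrite /mval !(tight_cval eL tD) //.
by case: c0 {tD} => [[] []] /=; rewrite ?addn0 ?addn1 ?minnn // /minn;
  rewrite ?ltnSn ?ltnNge ?leqnSn.
Qed.

Lemma tight_cval_eq D e L m c0 c : e \notin L -> tight D e L m c0 -> c != ff ->
  (cval D e L c == (mval D e L).+1) = (c == c0).
Proof.
move=> eL tD cn; rewrite (tight_mval eL tD) (tight_cval eL tD) //.
by case: (c == c0); rewrite ?addn1 ?eqxx // addn0 eqn_leq ltnn andbF.
Qed.

Lemma dual_pivot_feasible D N : feasible D != set0 -> feasible (dual_pivot D N) != set0.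
Proof.
move=> nD; apply: (dual_pivot_ind (P := fun D' => feasible D' != set0)) => // D' x nD' _.
have /set0Pn[F FD] := nD'.
apply: (@etype_feasible _ _ x (F :\ x)); rewrite etype_dual_pivot1 ?setD11 //.
by case: etype (etypeD1_neq0 x FD) => [[] []].
Qed.

Lemma subsetD1_notin A L e : L \subset A :\ e -> e \notin L.
Proof. by rewrite subsetD1 => /andP[]. Qed.

(* Each partition P of E - e contributes to exactly one of the three Qtype
   sums, and the distance of type c exceeds m by one when c is that type. *)
Lemma Qtype_sum U V W (f : {set T} * {set T} * {set T} -> R)
    (g : bool * bool -> R) t D e :
  tight_at D e ->
  (forall P m c0, ordered_partition3 (ground D :\ e) P ->
    tight (dual_pivot D P.2) e P.1.1 m c0 -> f P = t ^+ m * g c0) ->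
  \sum_(P | ordered_partition3 (ground D :\ e) P) weight U V W P * f P =
    Qtype U V W t D e (true, false) * g (true, false) +
    Qtype U V W t D e (false, true) * g (false, true) +
    Qtype U V W t D e (true, true) * g (true, true).
Proof.
move=> tD fE; rewrite !mulr_suml -!big_split; apply: eq_bigr => P opP.
have /andP[sL sN] := ordered_partition3_sub opP.
have [m [c0 tP]] := tD _ _ sL sN; have eL := subsetD1_notin sL.
rewrite (fE _ _ _ opP tP) !(tight_cval_eq eL tP) // (tight_mval eL tP).
by case: c0 tP => [[] []] [] //= _ _;
  rewrite !(mulr0n, mulr1n, mulr0, mul0r, add0r, addr0) mulrA.
Qed.

(** By [dist_two_sum] a partition of [ground D2 :\ e] matters only through its [m] and its type, so
    the inner sum becomes three [Qtype] weights, one for each block that may contain [e]. *)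
Lemma Qsum_two_sum U V W t D1 D2 e :
  proper_system D1 -> proper_system D2 -> ground D1 :&: ground D2 = [set e] ->
  feasible D1 != set0 -> tight_at D2 e ->
  Qsum U V W t (two_sum D1 D2 e) =
  Qsum [eta U with e |-> Qtype U V W t D2 e (true, false)]
       [eta V with e |-> Qtype U V W t D2 e (false, true)]
       [eta W with e |-> Qtype U V W t D2 e (true, true)] t D1.
Proof.
move=> p1 p2 m12 n1 t2.
have eE1 : e \in ground D1 by move/setP/(_ e): m12; rewrite !inE eqxx => /andP[].
have dE : [disjoint ground D1 :\ e & ground D2 :\ e].
  by rewrite -setI_eq0 -setDIl m12 setDv.
rewrite {1}/Qsum [ground _]/= setDUl sum_partition3U //.
pose pu := Qtype U V W t D2 e (true, false).
pose pv := Qtype U V W t D2 e (false, true).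
pose pw := Qtype U V W t D2 e (true, true).
transitivity (\sum_(P | ordered_partition3 (ground D1 :\ e) P) weight U V W P *
    (pu * t ^+ cval (dual_pivot D1 P.2) e P.1.1 (true, false) +
     pv * t ^+ cval (dual_pivot D1 P.2) e P.1.1 (false, true) +
     pw * t ^+ cval (dual_pivot D1 P.2) e P.1.1 (true, true))).
  apply: eq_bigr => P1 op1.
  have /andP[sL1 sN1] := ordered_partition3_sub op1.
  rewrite -(Qtype_sum U V W (f := fun P2 => t ^+ dist
    (dual_pivot (two_sum D1 D2 e) (P1.2 :|: P2.2)) (P1.1.1 :|: P2.1.1))
    (g := fun c => t ^+ cval (dual_pivot D1 P1.2) e P1.1.1 c) t2); last first.
    move=> P2 m c0 op2 tP; have /andP[sL2 sN2] := ordered_partition3_sub op2.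
    rewrite dual_pivot_two_sum // -exprD.
    rewrite (dist_two_sum _ _ _ _ _ _ tP) ?ground_dual_pivot //.
    - by apply: proper_dual_pivot => //; apply: subset_trans sN1 (subsetDl _ _).
    - by apply: proper_dual_pivot => //; apply: subset_trans sN2 (subsetDl _ _).
    - exact: dual_pivot_feasible.
  rewrite mulr_sumr; apply: eq_bigr => P2 op2.
  by rewrite (weight_union3 _ _ _ dE op1 op2) -mulrA.
(* On the other side, the partitions of [ground D1] are split according to the block of [e]. *)
have E1 : ground D1 = (ground D1 :\ e) :|: [set e] by rewrite setUC setD1K.
have dE1 : [disjoint ground D1 :\ e & [set e]].
  by rewrite disjoint_sym disjoints1 setD11.
set U' := [eta U with e |-> pu]; set V' := [eta V with e |-> pv].
set W' := [eta W with e |-> pw].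
rewrite /Qsum [in RHS]E1 sum_partition3U //; apply: eq_bigr => P op.
have /andP[sL sN] := ordered_partition3_sub op.
have eN := subsetD1_notin sN.
rewrite sum_partition3_1.
have op1 Q1 :
    Q1 \in [:: ([set e], set0, set0); (set0, [set e], set0); (set0, set0, [set e])] ->
    ordered_partition3 [set e] Q1.
  rewrite !inE => /or3P[] /eqP ->; apply/ordered_partition3P=> x;
  by rewrite /= !inE; case: (x == e).
rewrite !(weight_union3 _ _ _ dE1 op) ?op1 ?inE ?eqxx ?orbT //.
have -> : weight U' V' W' P = weight U V W P.
  by apply: (eq_weight op) => x /setD1P[/negPf xe _]; rewrite /U' /V' /W' /= xe.
have w1 : [/\ weight U' V' W' ([set e], set0, set0) = pu,
    weight U' V' W' (set0, [set e], set0) = pv &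
    weight U' V' W' (set0, set0, [set e]) = pw].
  by rewrite /weight /= !big_set1 !big_set0 /= eqxx !mulr1 !mul1r.
case: w1 => -> -> ->; rewrite /= !setU0 -!mulrA -!mulrDr.
by rewrite -dual_pivotU1 // ![_ :|: [set e]]setUC.
Qed.

(** Minors as functionals on the vectors: for non-singular [e], (1,0) is contraction, (0,1) deletion
    and (1,1) contraction after loop complement. *)
Definition is_minor D' D e c := forall X,
  (X \in feasible D') = (e \notin X) && cross (etype D e X) c.

Lemma is_minor_dual_pivot D' D e c N : e \notin N ->
  is_minor D' D e c -> is_minor (dual_pivot D' N) (dual_pivot D N) e c.
Proof.
move=> eN; rewrite /dual_pivot.
have: e \notin enum N by rewrite mem_enum.
elim: (enum N) D' D {eN} => //= x s IH D' D.
rewrite inE negb_or => /andP[ex es] mD; apply: IH => // X.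
rewrite mem_dual_pivot1 !mD etype_dual_pivot1_neq 1?eq_sym // !inE negb_or ex /=.
by case: (e \notin X); rewrite ?andbF.
Qed.

(** The two clauses of [tight] for [c] are precisely the two bounds on the distance in the minor
    given by [c]. *)
Lemma is_minor_dist D' D e L m c0 c : is_minor D' D e c ->
  tight D e L m c0 -> c != ff -> dist D' L = (m + (c == c0))%N.
Proof.
move=> mD [_ tD] cn; have [lb [X [eX cX le]]] := tD c cn.
apply: dist_eq; first by exists X; rewrite // mD eX.
by move=> F; rewrite mD => /andP[]; apply: lb.
Qed.

Lemma Qsum_minor U V W t D' D e c : ground D' = ground D :\ e ->
  is_minor D' D e c -> tight_at D e -> c != ff ->
  Qsum U V W t D' =
    Qtype U V W t D e (true, false) * t ^+ (c == (true, false)) +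
    Qtype U V W t D e (false, true) * t ^+ (c == (false, true)) +
    Qtype U V W t D e (true, true) * t ^+ (c == (true, true)).
Proof.
move=> gD mD tD cn; rewrite /Qsum gD.
apply: (Qtype_sum U V W (g := fun c0 => t ^+ (c == c0)) tD) => P m c0 op tP.
have /andP[_ sN] := ordered_partition3_sub op.
rewrite (is_minor_dist (is_minor_dual_pivot (subsetD1_notin sN) mD) tP cn).
exact: exprD.
Qed.

End TransitionSums.

(** * Isomorphisms and iterated two-sums *)

Section Isomorphisms.
Variable T : finType.
Implicit Types (D : set_system T) (F L N X : {set T}) (e x : T) (phi : T -> T).

Lemma dm_iso_dual_pivot1 D D' phi x : dm_iso D D' phi -> x \in ground D ->
  dm_iso (dual_pivot1 D x) (dual_pivot1 D' (phi x)) phi.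
Proof.
case=> inj gD fD xD; split=> //= F sF.
rewrite !mem_dual_pivot1 (mem_imset_on inj) // fD // -imsetU1 fD //.
by rewrite subUset sub1set xD.
Qed.

Lemma dm_iso_dual_pivot D D' phi N : dm_iso D D' phi -> N \subset ground D ->
  dm_iso (dual_pivot D N) (dual_pivot D' (phi @: N)) phi.
Proof.
move=> iso sN; have [inj _ _] := iso.
have -> : dual_pivot D' (phi @: N) = foldl (@dual_pivot1 T) D' (map phi (enum N)).
  apply: foldl_dual_pivot_perm; apply: uniq_perm; first exact: enum_uniq.
    rewrite map_inj_in_uniq ?enum_uniq // => x y; rewrite !mem_enum.
    by move=> xN yN; apply: inj; apply: (subsetP sN).
  move=> y; rewrite mem_enum; apply/imsetP/mapP => -[x xN ->]; exists x => //.
    by rewrite mem_enum.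
  by rewrite mem_enum in xN.
rewrite /dual_pivot; have: {subset enum N <= ground D}.
  by move=> x; rewrite mem_enum; apply: (subsetP sN).
elim: (enum N) D D' iso {sN inj} => //= x s IH D D' iso sN.
apply: IH; first by apply: dm_iso_dual_pivot1; rewrite ?sN ?mem_head.
by move=> y ys; apply: sN; rewrite inE ys orbT.
Qed.

Lemma imset_symdiff phi (A F X : {set T}) :
  {in A &, injective phi} -> F \subset A -> X \subset A ->
  phi @: symdiff F X = symdiff (phi @: F) (phi @: X).
Proof.
move=> inj sF sX.
have sS : symdiff F X \subset A by rewrite subUset !subDset !subsetU ?sF ?sX ?orbT.
apply/setP=> y; rewrite in_symdiff; apply/idP/idP => [/imsetP[x xS ->]|yS].
  have xA := subsetP sS x xS.
  by rewrite !(mem_imset_on inj) // -in_symdiff.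
have /imsetP[x xA yx] : y \in phi @: A.
  have [yF|yF] := boolP (y \in phi @: F); first by rewrite (subsetP (imsetS phi sF)).
  by rewrite (negPf yF) /= in yS; rewrite (subsetP (imsetS phi sX)).
by rewrite yx (mem_imset_on inj) // in_symdiff -!(mem_imset_on inj _ xA) // -yx.
Qed.

(** [dm_iso] speaks only of images of subsets of [ground D]; properness of [D'] makes every feasible
    set such an image. *)
Lemma dm_iso_feasible D D' phi F' : dm_iso D D' phi -> proper_system D' ->
  F' \in feasible D' ->
  exists F, [/\ F \subset ground D, F \in feasible D & F' = phi @: F].
Proof.
move=> [_ gD fD] pD' F'D; pose F := ground D :&: phi @^-1: F'.
have FE : F' = phi @: F.
  apply/setP=> y; apply/idP/imsetP => [yF|[x]]; last by rewrite !inE => /andP[_ xF] ->.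
  have := subsetP (pD' _ F'D) y yF; rewrite -gD => /imsetP[x xD yx].
  by exists x; rewrite // !inE xD -yx.
by exists F; rewrite subsetIl -fD ?subsetIl // -FE.
Qed.

Lemma dm_iso_dist D D' phi X : dm_iso D D' phi -> feasible D != set0 ->
  proper_system D -> proper_system D' -> X \subset ground D ->
  dist D' (phi @: X) = dist D X.
Proof.
move=> iso nD pD pD' sX; have [inj gD fD] := iso.
have card F : F \subset ground D -> #|symdiff (phi @: F) (phi @: X)| = #|symdiff F X|.
  move=> sF; rewrite -(imset_symdiff inj) //.
  have sS : symdiff F X \subset ground D.
    by rewrite subUset !subDset !subsetU ?sF ?sX ?orbT.
  by apply: card_in_imset; exact: sub_in2 (subsetP sS) _ inj.
apply: dist_eq => [|F' /(dm_iso_feasible iso pD')[F [sF FD ->]]].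
  have [F FD <-] := dist_attained X nD.
  by exists (phi @: F); rewrite ?card ?fD ?pD.
by rewrite card // dist_le.
Qed.

Lemma dm_iso_singular D D' phi e : dm_iso D D' phi -> proper_system D' ->
  e \in ground D -> singular D e -> singular D' (phi e).
Proof.
move=> iso pD' eD; have [inj _ fD] := iso; case/or3P=> /forall_inP h; apply/or3P.
- constructor 1; apply/forall_inP=> F' /(dm_iso_feasible iso pD')[F [sF FD ->]].
  by rewrite (mem_imset_on inj) // h.
- constructor 2; apply/forall_inP=> F' /(dm_iso_feasible iso pD')[F [sF FD ->]].
  by rewrite (mem_imset_on inj) // h.
- constructor 3; apply/forall_inP=> F' /(dm_iso_feasible iso pD')[F [sF FD ->]].
  have se : [set e] \subset ground D by rewrite sub1set.
  rewrite -imset_set1 -(imset_symdiff inj) // fD ?h //.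
  by rewrite subUset !subDset !subsetU ?sF ?se ?orbT.
Qed.

Lemma dm_iso_cval D D' phi e L c : dm_iso D D' phi -> feasible D != set0 ->
  proper_system D -> proper_system D' -> e \in ground D -> L \subset ground D ->
  cval D' (phi e) (phi @: L) c = cval D e L c.
Proof.
move=> iso nD pD pD' eD sL; have [inj gD fD] := iso.
have phieD : phi e \in ground D' by rewrite -gD imset_f.
have dp (S : set_system T) x : dual_pivot1 S x = dual_pivot S [set x].
  by rewrite /dual_pivot enum_set1.
have mixed : dist (dual_pivot1 D' (phi e)) (phi @: L) = dist (dual_pivot1 D e) L.
  rewrite (dm_iso_dist (dm_iso_dual_pivot1 iso eD)) // !dp.
  - exact: dual_pivot_feasible.
  - by apply: proper_dual_pivot; rewrite ?sub1set.
  - by apply: proper_dual_pivot; rewrite ?sub1set.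
rewrite /cval; case: c => [[] []] //; last by rewrite (dm_iso_dist iso).
by rewrite -imsetU1 (dm_iso_dist iso) // subUset sub1set eD.
Qed.

Lemma eq_Qsum (R : comNzRingType) (U V W U' V' W' : T -> R) t D :
  {in ground D, U =1 U'} -> {in ground D, V =1 V'} -> {in ground D, W =1 W'} ->
  Qsum U V W t D = Qsum U' V' W' t D.
Proof.
move=> hU hV hW; apply: eq_bigr => P op.
by rewrite (eq_weight op hU hV hW).
Qed.

Lemma eq_Qtype (R : comNzRingType) (U V W U' V' W' : T -> R) t D e c :
  {in ground D :\ e, U =1 U'} -> {in ground D :\ e, V =1 V'} ->
  {in ground D :\ e, W =1 W'} -> Qtype U V W t D e c = Qtype U' V' W' t D e c.
Proof.
move=> hU hV hW; apply: eq_bigr => P op.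
by rewrite (eq_weight op hU hV hW).
Qed.

Lemma dm_iso_Qtype (R : comNzRingType) (U V W : T -> R) t D D' phi e c :
  dm_iso D D' phi -> feasible D != set0 ->
  proper_system D -> proper_system D' -> e \in ground D ->
  Qtype U V W t D' (phi e) c = Qtype (U \o phi) (V \o phi) (W \o phi) t D e c.
Proof.
move=> iso nD pD pD' eD; have [inj gD fD] := iso.
have injE : {in ground D :\ e &, injective phi}.
  exact: sub_in2 (subsetP (subsetDl _ _)) _ inj.
rewrite /Qtype.
have -> : ground D' :\ phi e = phi @: (ground D :\ e).
  apply/setP=> y; rewrite in_setD1 -gD.
  apply/andP/imsetP => [[ye /imsetP[x xD yx]]|[x /setD1P[xe xD] ->]].
    by exists x; rewrite // in_setD1 xD andbT; apply: contraNneq ye => <-; rewrite yx.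
  by rewrite imset_f //; split=> //; apply: contraNneq xe => /inj ->.
rewrite (sum_partition3_imset _ injE); apply: eq_bigr => P op.
have /andP[sL sN] := ordered_partition3_sub op.
have sL' := subset_trans sL (subsetDl _ _); have sN' := subset_trans sN (subsetDl _ _).
have sM : P.1.2 \subset ground D :\ e.
  move/ordered_partition3P: op => h; apply/subsetP=> x xM; move: (h x); rewrite xM.
  by case: (x \in _) => //; case: (x \in _).
congr (_ * _)%R.
  rewrite /weight /= !big_imset //=;
  by move=> x y xP yP; apply: injE;
    rewrite ?(subsetP sL _ xP) ?(subsetP sM _ xP) ?(subsetP sN _ xP)
      ?(subsetP sL _ yP) ?(subsetP sM _ yP) ?(subsetP sN _ yP).
have isoN := dm_iso_dual_pivot iso sN'.
have nN : feasible (dual_pivot D P.2) != set0 by apply: dual_pivot_feasible.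
have pN : proper_system (dual_pivot D P.2) by apply: proper_dual_pivot.
have pN' : proper_system (dual_pivot D' (phi @: P.2)).
  by apply: proper_dual_pivot; rewrite // -gD imsetS.
by rewrite /mval !(dm_iso_cval _ isoN nN pN pN') ?ground_dual_pivot.
Qed.

End Isomorphisms.

Lemma rmorph_weight (R S : comNzRingType) (f : {rmorphism R -> S}) (T : finType)
    (U V W : T -> R) P :
  f (weight U V W P) = weight (f \o U) (f \o V) (f \o W) P.
Proof. by rewrite /weight !rmorphM !rmorph_prod. Qed.

Lemma rmorph_Qsum (R S : comNzRingType) (f : {rmorphism R -> S}) (T : finType)
    (U V W : T -> R) t (D : set_system T) :
  f (Qsum U V W t D) = Qsum (f \o U) (f \o V) (f \o W) (f t) D.
Proof.
rewrite rmorph_sum; apply: eq_bigr => P _.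
by rewrite rmorphM rmorphXn rmorph_weight.
Qed.

Lemma rmorph_Qtype (R S : comNzRingType) (f : {rmorphism R -> S}) (T : finType)
    (U V W : T -> R) t (D : set_system T) e c :
  f (Qtype U V W t D e c) = Qtype (f \o U) (f \o V) (f \o W) (f t) D e c.
Proof.
rewrite rmorph_sum; apply: eq_bigr => P _.
by rewrite rmorphM rmorphMn rmorphXn rmorph_weight.
Qed.

(** * Iterated two-sums along the elements of [D1] *)

Section Tensor.
Variables (T : finType) (De : T -> set_system T).
Implicit Types (D : set_system T) (s : seq T).

Definition tensor D s := foldl (fun D' e => two_sum D' (De e) e) D s.

Lemma two_sum_feasible D1 D2 e :
  proper_system D1 -> proper_system D2 -> ground D1 :&: ground D2 = [set e] ->
  feasible D1 != set0 -> tight_at D2 e -> feasible (two_sum D1 D2 e) != set0.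
Proof.
move=> p1 p2 m12 /set0Pn[F FD] t2.
have n1 := etypeD1_neq0 e FD.
have [m [c0]] := t2 _ _ (sub0set _) (sub0set _); rewrite dual_pivot0 => -[_ /(_ _ n1)].
case=> _ [X [eX cX _]].
have nX : etype D2 e X != ff by move: cX; rewrite crossE => /and3P[].
have sX := etype_sub p2 nX.
apply/set0Pn; exists ((F :|: X) :\ e); rewrite mem_two_sum //.
rewrite setSD ?setUSS ?p1 //= (two_sum_parts m12) ?p1 //.
have m21 : ground D2 :&: ground D1 = [set e] by rewrite setIC.
by rewrite [F :|: X]setUC (two_sum_parts m21) ?p1 // (setD1_notin eX) crossC.
Qed.

Variable D1 : set_system T.
Hypotheses (p1 : proper_system D1) (n1 : feasible D1 != set0).
Hypothesis De_proper : {in ground D1, forall e, proper_system (De e)}.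
Hypothesis De_tight : {in ground D1, forall e, tight_at (De e) e}.
Hypothesis De_disjoint : {in ground D1 &, forall e f, e != f ->
  [disjoint ground (De e) & ground (De f)]}.
Hypothesis De_meet :
  {in ground D1, forall e, ground D1 :&: ground (De e) = [set e]}.

Lemma tensor_ground s x : x \in ground (tensor D1 s) ->
  (x \in ground D1) || has (fun e => x \in ground (De e)) s.
Proof.
elim/last_ind: s => [|s e IH]; first by rewrite orbF.
rewrite /tensor foldl_rcons has_rcons /= !inE => /andP[_ /orP[/IH/orP[->|->]|->]] //;
by rewrite ?orbT.
Qed.

Lemma tensor_ground_notin s x :
  x \in ground D1 -> x \notin s -> x \in ground (tensor D1 s).
Proof.
move=> xD; elim/last_ind: s => [|s e IH] //.
by rewrite mem_rcons inE negb_or /tensor foldl_rcons /= !inE => /andP[-> /IH ->].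
Qed.

(** A common element comes from [D1], hence is [e], or from some [De f] with [f] different from [e],
    which is disjoint from [De e]. *)
Lemma tensor_step s e : e \in ground D1 -> {subset s <= ground D1} -> e \notin s ->
  ground (tensor D1 s) :&: ground (De e) = [set e].
Proof.
move=> eD ss es; apply/setP=> x; rewrite !inE; apply/andP/eqP => [[xs xe]|->].
  case/orP: (tensor_ground xs) => [xD|/hasP[f fs xf]].
    by apply/set1P; rewrite -(De_meet eD) inE xD.
  have ef : e != f by apply: contraNneq es => ->.
  by rewrite (disjointFr (De_disjoint eD (ss f fs) ef) xe) in xf.
split; first exact: tensor_ground_notin.
by move/setP/(_ e): (De_meet eD); rewrite !inE eqxx => /andP[].
Qed.

Lemma tensor_proper_feasible s : uniq s -> {subset s <= ground D1} ->
  proper_system (tensor D1 s) /\ feasible (tensor D1 s) != set0.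
Proof.
elim/last_ind: s => // s e IH; rewrite rcons_uniq => /andP[es us] ss.
have eD : e \in ground D1 by apply: ss; rewrite mem_rcons mem_head.
have {}ss : {subset s <= ground D1}.
  by move=> x xs; apply: ss; rewrite mem_rcons inE xs orbT.
have [p n] := IH us ss; rewrite /tensor foldl_rcons; split.
  by apply: proper_two_sum => //; apply: De_proper.
by apply: two_sum_feasible => //; [apply: De_proper|apply: tensor_step|apply: De_tight].
Qed.

(** The last two-sum changes the weights of its element; the induction runs over all [U V W] so that
    it applies to the changed ones. *)
Lemma Qsum_tensor (R : comNzRingType) (U V W : T -> R) t s :
  uniq s -> {subset s <= ground D1} ->
  Qsum U V W t (tensor D1 s) =
  Qsum (fun x => if x \in s then Qtype U V W t (De x) x (true, false) else U x)
       (fun x => if x \in s then Qtype U V W t (De x) x (false, true) else V x)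
       (fun x => if x \in s then Qtype U V W t (De x) x (true, true) else W x)
       t D1.
Proof.
elim/last_ind: s U V W => // s e IH U V W; rewrite rcons_uniq => /andP[es us] ss.
have eD : e \in ground D1 by apply: ss; rewrite mem_rcons mem_head.
have {}ss : {subset s <= ground D1}.
  by move=> x xs; apply: ss; rewrite mem_rcons inE xs orbT.
have [p n] := tensor_proper_feasible us ss.
rewrite {1}/tensor foldl_rcons Qsum_two_sum ?IH //;
  [|exact: De_proper|exact: tensor_step|exact: De_tight].
(* The weight changed at [e] does not enter the sums for the other [De x], whose ground sets avoid
   [e]. *)
have off x y : x \in s -> y \in ground (De x) -> (y == e) = false.
  move=> xs yx; apply/negP=> /eqP ye.
  have ex : e != x by apply: contraNneq es => ->.
  have eDe : e \in ground (De e).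
    by move/setP/(_ e): (De_meet eD); rewrite !inE eqxx => /andP[].
  by rewrite ye (disjointFr (De_disjoint eD (ss x xs) ex) eDe) in yx.
apply: eq_Qsum => x _; rewrite mem_rcons inE; case: (boolP (x \in s)) => xs;
  rewrite ?orbT ?orbF //=; first [by case: (eqVneq x e) => [->|] |
  by apply: eq_Qtype => y /setD1P[_ /(off _ _ xs)] /= -> ].
Qed.

End Tensor.

(** * Polynomials *)

(** The matrix has determinant [(t - 1)^2 (t + 2)]: differences of equations carry the factor
    [t - 1], and once the unknowns agree [t + 2] remains. *)
Lemma transition_system_inj (R : idomainType) (t a b c : R) :
  (t - 1 != 0 -> t + 2 != 0 ->
  t * a + b + c = 0 -> a + t * b + c = 0 -> a + b + t * c = 0 ->
  [/\ a = 0, b = 0 & c = 0])%R.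
Proof.
move=> t1 t2 e1 e2 e3.
have ab : (a = b)%R.
  apply/subr0_eq/(mulfI t1); rewrite mulr0.
  by transitivity ((t * a + b + c) - (a + t * b + c))%R; [ring | rewrite e1 e2 subrr].
have bc : (b = c)%R.
  apply/subr0_eq/(mulfI t1); rewrite mulr0.
  by transitivity ((a + t * b + c) - (a + b + t * c))%R; [ring | rewrite e2 e3 subrr].
have c0 : (c = 0)%R.
  apply/(mulfI t2); rewrite mulr0 -e1 ab bc; ring.
by rewrite ab bc c0.
Qed.

Section Polynomials.
Variable T : finType.
Local Open Scope ring_scope.
Local Notation tpoly := {mpoly int[#|tvar T|]}.
Implicit Types (A : {set T}) (D : set_system T) (p q : tpoly).

Lemma poly_on_X A x : x \in tvars_on A -> poly_on A (tX x).
Proof.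
move=> xA m; rewrite /tX msuppX inE => /eqP -> i; rewrite mnm1E.
by case: (enum_rank x =P i) => [<- _|_]; rewrite ?enum_rankK.
Qed.

Lemma poly_on1 A : poly_on A (1 : tpoly).
Proof. by move=> m; rewrite msupp1 inE => /eqP -> i; rewrite mnm0E. Qed.

Lemma poly_on0 A : poly_on A (0 : tpoly).
Proof. by move=> m; rewrite msupp0. Qed.

Lemma poly_onD A p q : poly_on A p -> poly_on A q -> poly_on A (p + q).
Proof.
move=> hp hq m /msuppD_le; rewrite mem_cat => /orP[]; [exact: hp|exact: hq].
Qed.

Lemma poly_onM A p q : poly_on A p -> poly_on A q -> poly_on A (p * q).
Proof.
move=> hp hq m /msuppM_le /allpairsP[[m1 m2] /= [m1p m2q ->]] i.
rewrite mnmDE addn_eq0 negb_and => /orP[]; [exact: hp|exact: hq].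
Qed.

Lemma poly_on_prod A (I : finType) (P : pred I) (G : I -> tpoly) :
  (forall i, P i -> poly_on A (G i)) -> poly_on A (\prod_(i | P i) G i).
Proof. by move=> h; apply: big_ind => //; [exact: poly_on1|exact: poly_onM]. Qed.

Lemma poly_on_sum A (I : finType) (P : pred I) (G : I -> tpoly) :
  (forall i, P i -> poly_on A (G i)) -> poly_on A (\sum_(i | P i) G i).
Proof. by move=> h; apply: big_ind => //; [exact: poly_on0|exact: poly_onD]. Qed.

Lemma poly_onXn A p n : poly_on A p -> poly_on A (p ^+ n).
Proof.
move=> hp; elim: n => [|n IH]; first by rewrite expr0; apply: poly_on1.
by rewrite exprS; apply: poly_onM.
Qed.

Definition tXu (x : T) : tpoly := tX (uv x).
Definition tXv (x : T) : tpoly := tX (vv x).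
Definition tXw (x : T) : tpoly := tX (wv x).
Definition tXt : tpoly := tX (tv T).

Lemma poly_on_Qtype D e c :
  poly_on (ground D :\ e) (Qtype tXu tXv tXw tXt D e c).
Proof.
apply: poly_on_sum => P /ordered_partition3P h.
have hin x : (x \in P.1.1) || (x \in P.1.2) || (x \in P.2) -> x \in ground D :\ e.
  by move: (h x); do 4 case: (x \in _) => //=.
apply: poly_onM; last first.
  case: (_ == _); last exact: poly_on0.
  by rewrite mulr1n; apply/poly_onXn/poly_on_X; rewrite /tvars_on setU11.
apply: poly_onM; first apply: poly_onM.
all: apply: poly_on_prod => x xP; apply: poly_on_X;
  rewrite !inE imset_f ?orbT //; apply: hin; rewrite xP ?orbT //.
Qed.

Lemma Q_Qsum D : Q D = Qsum tXu tXv tXw tXt D.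
Proof. by apply: eq_bigr => -[[L M] N]. Qed.

HB.instance Definition _ (s : tvar T -> tpoly) :=
  GRing.RMorphism.copy (tsubst s) (comp_mpoly [tuple s (enum_val i) | i < #|tvar T|]).

Lemma tsubst_X (s : tvar T -> tpoly) x : tsubst s (tX x) = s x.
Proof.
by rewrite /tsubst /tX comp_mpolyXU -tnth_nth tnth_mktuple enum_rankK.
Qed.

Lemma subst_uvw_Q A U V W D :
  subst_uvw A U V W (Q D) =
  Qsum (fun x => if x \in A then U x else tXu x)
       (fun x => if x \in A then V x else tXv x)
       (fun x => if x \in A then W x else tXw x) tXt D.
Proof.
rewrite Q_Qsum /subst_uvw rmorph_Qsum /= tsubst_X.
by apply: eq_Qsum => x _ /=; rewrite tsubst_X.
Qed.

Lemma rename_Qtype (f : T -> T) D e c :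
  rename f (Qtype tXu tXv tXw tXt D e c) =
  Qtype (tXu \o f) (tXv \o f) (tXw \o f) tXt D e c.
Proof.
rewrite /rename rmorph_Qtype /= tsubst_X.
by apply: eq_Qtype => x _ /=; rewrite tsubst_X.
Qed.

Lemma inv_onK A (phi : T -> T) : {in A &, injective phi} ->
  {in A, cancel phi (inv_on A phi)}.
Proof.
move=> inj x xA; rewrite /inv_on; case: pickP => [y /andP[yA /eqP]|/(_ x)].
  exact: inj.
by rewrite xA eqxx.
Qed.

Lemma iso_inv_Qtype D D' (phi : T -> T) e c :
  dm_iso D D' phi -> vf_safe D -> vf_safe D' -> e \in ground D ->
  iso_inv D phi (Qtype tXu tXv tXw tXt D' (phi e) c) =
  Qtype tXu tXv tXw tXt D e c.
Proof.
move=> iso vf vf' eD; have [inj _ _] := iso.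
rewrite /iso_inv rename_Qtype (dm_iso_Qtype _ _ _ _ _ iso (vf_safe_feasible vf)
  (vf_safe_proper vf) (vf_safe_proper vf') eD).
by apply: eq_Qtype => x /setD1P[_ xD] /=; rewrite inv_onK.
Qed.

(** Non-singularity provides a feasible set containing [e], so the loop convention of [contract]
    does not arise. *)
Lemma contract_minor D e : nonsingular D e -> is_minor (contract D e) D e (true, false).
Proof.
move=> ns X; rewrite /contract ifN; first by
  rewrite mem_raw_contract /cross /= andbF andbT.
have [X0 eX0] := ns (true, false) isT; rewrite /cross /= andbF andbT addFb => XD.
by rewrite negb_forall; apply/existsP; exists (e |: X0);
  rewrite negb_imply XD /= negbK setU11.
Qed.

Lemma delete_minor D e : nonsingular D e -> is_minor (delete D e) D e (false, true).
Proof.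
move=> ns X; rewrite /delete ifN; first by
  rewrite mem_raw_delete /cross /= andbF andbT addbF andbC.
have [X0 eX0] := ns (false, true) isT; rewrite /cross /= andbF andbT addbF => XD.
by rewrite negb_forall; apply/existsP; exists X0; rewrite negb_imply XD.
Qed.

(** Loop complement puts [b.1 (+) b.2] into the second coordinate, the one read by contraction. *)
Lemma contract_loop_compl_minor D e : nonsingular D e ->
  is_minor (contract (loop_compl D e) e) D e (true, true).
Proof.
move=> ns.
have nsL : nonsingular (loop_compl D e) e.
  (* The functional of [(c1, c2)] pulled back along the shear is that of [(c1, c1 (+) c2)]. *)
  case=> c1 c2 cn; have [|X eX cX] := ns (c1, c1 (+) c2).
    by case: c1 c2 cn => [] [].
  exists X; rewrite // etype_loop_compl //; move: cX; rewrite /cross /=.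
  by case: c1 c2 {cn} => [] [] /=; do 2 case: (_ \in _).
move=> X; rewrite (contract_minor nsL).
case: (boolP (e \notin X)) => //= eX; rewrite etype_loop_compl // /cross /=.
by rewrite andbF !andbT.
Qed.

Lemma tXt_sub1_neq0 : tXt - 1 != 0.
Proof.
(* The coefficient of the monomial [t] is 1 on the left and 0 on the right. *)
apply/eqP=> /(congr1 (fun p => p@_U_(enum_rank (tv T)))).
rewrite mcoeffB /tXt /tX mcoeffXU eqxx mcoeff1 mcoeff0 mnm1_eq0 //.
Qed.

Lemma tXt_add2_neq0 : tXt + 2 != 0.
Proof.
apply/eqP=> /(congr1 (fun p => p@_U_(enum_rank (tv T)))).
rewrite mcoeffD /tXt /tX mcoeffXU eqxx mcoeffMn mcoeff1 mcoeff0 mnm1_eq0 //.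
Qed.

Lemma transition_system_solution D e : vf_safe D -> e \in ground D ->
  ~~ singular D e ->
  transition_system D e (Qtype tXu tXv tXw tXt D e (true, false))
    (Qtype tXu tXv tXw tXt D e (false, true))
    (Qtype tXu tXv tXw tXt D e (true, true)).
Proof.
move=> vf eD sD; have ns := nonsingularP sD.
have tD : tight_at D e by move=> L N; apply: vf_safe_tight.
split; first by split; [|split]; apply: poly_on_Qtype.
- have gD : ground (contract D e) = ground D :\ e by rewrite /contract; case: ifP.
  rewrite Q_Qsum (Qsum_minor _ _ _ _ gD (contract_minor ns) tD) //.
  (* The three sums are abstracted so that simplification only touches the exponents of [t]. *)
  move: (Qtype _ _ _ _ _ _ _) (Qtype _ _ _ _ _ _ (false, true))
    (Qtype _ _ _ _ _ _ (true, true)) => p q r.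
  by rewrite !xpair_eqE /= ?expr1 ?expr0 ?mulr1 [tX _ * _]mulrC.
- have gD : ground (delete D e) = ground D :\ e by rewrite /delete; case: ifP.
  rewrite Q_Qsum (Qsum_minor _ _ _ _ gD (delete_minor ns) tD) //.
  move: (Qtype _ _ _ _ _ _ _) (Qtype _ _ _ _ _ _ (false, true))
    (Qtype _ _ _ _ _ _ (true, true)) => p q r.
  by rewrite !xpair_eqE /= ?expr1 ?expr0 ?mulr1 [tX _ * _]mulrC.
- have gD : ground (contract (loop_compl D e) e) = ground D :\ e.
    by rewrite /contract; case: ifP.
  rewrite Q_Qsum (Qsum_minor _ _ _ _ gD (contract_loop_compl_minor ns) tD) //.
  move: (Qtype _ _ _ _ _ _ _) (Qtype _ _ _ _ _ _ (false, true))
    (Qtype _ _ _ _ _ _ (true, true)) => p q r.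
  by rewrite !xpair_eqE /= ?expr1 ?expr0 ?mulr1 [tX _ * _]mulrC.
Qed.

Lemma transition_system_unique D e p q r p' q' r' :
  transition_system D e p q r -> transition_system D e p' q' r' ->
  [/\ p' = p, q' = q & r' = r].
Proof.
move=> [_ e1 e2 e3] [_ f1 f2 f3].
have [||||| /subr0_eq-> /subr0_eq-> /subr0_eq->] //:=
  @transition_system_inj _ tXt (p' - p) (q' - q) (r' - r).
- exact: tXt_sub1_neq0.
- exact: tXt_add2_neq0.
- by transitivity ((tXt * p' + q' + r') - (tXt * p + q + r)); [ring|
  rewrite -f1 -e1 subrr].
- by transitivity ((p' + tXt * q' + r') - (p + tXt * q + r)); [ring|
  rewrite -f2 -e2 subrr].
- by transitivity ((p' + q' + tXt * r') - (p + q + tXt * r)); [ring|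
  rewrite -f3 -e3 subrr].
Qed.

End Polynomials.

Theorem theorem26 (T : finType) (D1 D2 : set_system T) (a : T)
    (De : T -> set_system T) (phi : T -> T -> T) (D : set_system T)
    (vf1 : vf_safe D1)
    (ns1 : {in ground D1, forall e, ~~ singular D1 e})
    (vf2 : vf_safe D2)
    (aD2 : a \in ground D2)
    (ns2 : ~~ singular D2 a)
    (fam : tensor_family D1 D2 a De phi)
    (tens : is_tensor D1 De D) :
  exists p q r : {mpoly int[#|tvar T|]},
    [/\ transition_system D2 a p q r,
        (forall p' q' r' : {mpoly int[#|tvar T|]},
           transition_system D2 a p' q' r' -> [/\ p' = p, q' = q & r' = r]) &
        Q D = subst_uvw (ground D1)
                (fun e => iso_inv (De e) (phi e) p)
                (fun e => iso_inv (De e) (phi e) q)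
                (fun e => iso_inv (De e) (phi e) r) (Q D1)].
Proof.
have [vfDe disjDe meetDe isoDe] := fam.
have sol := transition_system_solution vf2 aD2 ns2.
exists (Qtype (@tXu T) (@tXv T) (@tXw T) (tXt T) D2 a (true, false)),
  (Qtype (@tXu T) (@tXv T) (@tXw T) (tXt T) D2 a (false, true)),
  (Qtype (@tXu T) (@tXv T) (@tXw T) (tXt T) D2 a (true, true)).
split=> // [p' q' r'|]; first exact: transition_system_unique.
have [s ps ->] := tens.
have us : uniq s by rewrite (perm_uniq ps) enum_uniq.
have sE x : (x \in s) = (x \in ground D1) by rewrite (perm_mem ps) mem_enum.
have eDe e : e \in ground D1 -> e \in ground (De e).
  by move=> /meetDe /setP/(_ e); rewrite !inE eqxx => /andP[].
rewrite Q_Qsum -/(tensor De D1 s) Qsum_tensor //; first last.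
- by move=> x; rewrite sE.
- move=> e eD L N; apply: vf_safe_tight; [exact: vfDe|exact: eDe|].
  (* If [e] were singular in [De e], the isomorphism would make [a] singular in [D2]. *)
  have [iso pa] := isoDe e eD; apply: contra ns2; rewrite -pa.
  by apply: dm_iso_singular iso _ _; [exact: vf_safe_proper|exact: eDe].
- by move=> e /vfDe; apply: vf_safe_proper.
- exact: vf_safe_feasible.
- exact: vf_safe_proper.
rewrite subst_uvw_Q.
(* Since [phi e] carries [De e] to [D2] and [e] to [a], pulling back the solution for [D2] gives the
   weights produced by [De e]. *)
have inv e c : e \in ground D1 ->
    iso_inv (De e) (phi e) (Qtype (@tXu T) (@tXv T) (@tXw T) (tXt T) D2 a c) =
    Qtype (@tXu T) (@tXv T) (@tXw T) (tXt T) (De e) e c.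
  move=> eD; have [iso pa] := isoDe e eD; rewrite -pa iso_inv_Qtype //.
    exact: vfDe.
  exact: eDe.
by apply: eq_Qsum => x xD /=; rewrite sE xD inv.
Qed.
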